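(* Let $d_1,d_2$ be positive integers and let $U<\mathbb{R}^{d_1}$ be a subspace which is rational with respect to $\mathbb{Z}^{d_1}$. Let $\gamma_n:\mathbb{T}^{d_1}\to\mathbb{T}^{d_2}$ be a sequence of homomorphisms induced by integer matrices $\gamma_n\in\mathrm{Mat}_{d_2\times d_1}(\mathbb{Z})$. Assume the sequence $(\gamma_n)_*\lambda_U$ converges weak$^*$ to $\mu\in\mathcal{P}(\mathbb{T}^{d_2})$. Then there exists a subspace $V<\mathbb{R}^{d_2}$, rational with respect to $\mathbb{Z}^{d_2}$, such that $\mu=\lambda_V$. Furthermore, the sequence $\gamma_n$ mixes $\lambda_U$ to $\lambda_V$ if and only if there are no integer vectors $\mathbf{m}\in\mathbb{Z}^{d_2}$ and $0\ne\mathbf{k}\in U\cap\mathbb{Z}^{d_1}$ satisfying $\gamma_n^t\mathbf{m}+\mathbf{k}\in U^\perp$ for infinitely many $n$.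
   Context: $\mathbb{T}^k=\mathbb{R}^k/\mathbb{Z}^k$; matrices act on column vectors, and $\gamma_n^t$ is the transpose. A subspace $U<\mathbb{R}^k$ is rational with respect to $\mathbb{Z}^k$ if $U\cap\mathbb{Z}^k$ is a lattice in $U$; then $U+\mathbb{Z}^k$ is a closed connected subgroup (subtorus) of $\mathbb{T}^k$, and $\lambda_U$ denotes its Haar probability measure, regarded as a measure on $\mathbb{T}^k$ (for $U=\{0\}$ this is the point mass at $0$). $U^\perp$ is the orthogonal complement for the standard inner product. $\mathcal{P}(X)$ is the space of Borel probability measures on a compact metric space $X$, and $\gamma_*\eta(B)=\eta(\gamma^{-1}(B))$ is the push-forward. For compact metric spaces $X,Y$, $\eta\in\mathcal{P}(X)$, $\nu\in\mathcal{P}(Y)$, a sequence of measurable maps $\gamma_n:X\to Y$ mixes $\eta$ to $\nu$ if for every probability measure $\eta'\ll\eta$ (absolutely continuous), $(\gamma_n)_*\eta'\to\nu$ in the weak$^*$ topology. *)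

(* Defs.v *)
From HB Require Import structures.
From mathcomp Require Import all_boot all_order all_algebra.
From mathcomp Require Import generic_quotient ring_quotient archimedean.
From mathcomp Require Import all_classical all_reals all_analysis.

Set Implicit Arguments.
Unset Strict Implicit.
Unset Printing Implicit Defensive.

Import Order.TTheory GRing.Theory Num.Theory.
Import numFieldNormedType.Exports.

Local Open Scope classical_set_scope.
Local Open Scope ring_scope.
Local Open Scope quotient_scope.

Notation borel T := (g_sigma_algebraType (@open T)).

Lemma continuous_borel_measurable (X Y : ptopologicalType) (f : X -> Y) :
  continuous f -> measurable_fun [set: borel X] (f : borel X -> borel Y).
Proof.
move=> /continuousP cf; apply: (@measurability
  _ _ (borel X) (borel Y) setT f (@open Y) erefl).
by move=> _ [B oB <-]; rewrite setTI; apply: sub_sigma_algebra; exact: cf.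
Qed.

(* Weak-* convergence of Borel probability measures; on a compact space every
   continuous function is bounded. *)
Definition weak_star_cvg (R : realType) (X : ptopologicalType)
    (mu : nat -> probability (borel X) R) (nu : probability (borel X) R) :=
  forall f : X -> R, continuous f ->
    (\int[mu n]_(x in [set: borel X]) (f x)%:E @[n --> \oo] -->
     \int[nu]_(x in [set: borel X]) (f x)%:E)%E.

Definition mixes (R : realType) (X Y : ptopologicalType)
    (g : nat -> {mfun borel X >-> borel Y})
    (eta : probability (borel X) R) (nu : probability (borel Y) R) :=
  forall eta' : probability (borel X) R, eta' `<< eta ->
    weak_star_cvg (fun n => distribution eta' (g n)) nu.

Lemma mx_continuous (R : realType) (T : topologicalType) m n
    (f : T -> 'M[R]_(m, n)) :
  (forall i j, continuous (fun x => f x i j)) -> continuous f.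
Proof.
move=> cf x A [P nP PA].
have : nbhs x [set y | forall i j, P i j (f y i j)].
  by apply: filter_forall => i; apply: filter_forall => j; exact/cf/nP.
by apply: filterS => y Py; exact: PA.
Qed.

Section torus.
Variables (R : realType) (k : nat).

Definition int_lattice (x : 'cV[R]_k) : bool := x \is a mxOver Num.int.

Lemma int_lattice_zmod_closed : zmod_closed int_lattice.
Proof.
rewrite /int_lattice; split=> [|x y /mxOverP xZ /mxOverP yZ]; apply/mxOverP.
  by move=> i j; rewrite mxE rpred0.
by move=> i j; rewrite !mxE rpredB.
Qed.

HB.instance Definition _ :=
  GRing.isZmodClosed.Build _ int_lattice int_lattice_zmod_closed.

Definition torus_quot : Type :=
  Quotient.quot (GRing.ZmodClosed.clone 'cV[R]_k int_lattice _).

HB.instance Definition _ := ZmodQuotient.on torus_quot.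

(* R^k / Z^k with the quotient topology *)
Definition torus : Type := quotient_topology torus_quot.

HB.instance Definition _ := PointedTopological.on torus.
HB.instance Definition _ := Quotient.on torus.

HB.instance Definition _ := GRing.isZmodule.Build torus
  (@addrA torus_quot) (@addrC torus_quot) (@add0r torus_quot)
  (@addNr torus_quot).

Definition to_torus (x : 'cV[R]_k) : torus := \pi_torus x.

Lemma to_torusP (x y : 'cV[R]_k) :
  to_torus x = to_torus y <-> int_lattice (x - y).
Proof.
have e : int_lattice (x - y) = (x == y %[mod torus_quot]).
  exact: Quotient.idealrBE.
by split=> [xy|]; rewrite e; [exact/eqP | move/eqP].
Qed.

Lemma to_torusD (x y : 'cV[R]_k) : to_torus (x + y) = to_torus x + to_torus y.
Proof. exact: (raddfD \pi_torus_quot). Qed.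

Definition is_lattice_in (L : set 'cV[R]_k) (U : {vspace 'cV[R]_k}) :=
  exists2 b : (\dim U).-tuple 'cV[R]_k,
    basis_of U b & L = [set x | inIntSpan b x].

Definition rational_subspace (U : {vspace 'cV[R]_k}) :=
  is_lattice_in [set x | x \in U /\ int_lattice x] U.

Definition subtorus (U : {vspace 'cV[R]_k}) : set torus :=
  to_torus @` [set` U].

(* The Haar probability measure of a closed subgroup H, extended by 0 outside H
   to the whole torus; these two properties determine it uniquely on Borel
   sets, so it is stated as a predicate rather than as a chosen measure. *)
Definition is_haar (H : set torus) (mu : probability (borel torus) R) :=
  mu H = 1%E /\
  forall (h : torus) (B : set (borel torus)), H h -> measurable B ->
    mu [set x : torus | B (x + h)] = mu B.

Definition dot (u v : 'cV[R]_k) : R := \sum_(i < k) u i 0 * v i 0.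

Definition orth (U : {vspace 'cV[R]_k}) : set 'cV[R]_k :=
  [set w | forall u, u \in U -> dot w u = 0].

Definition int_vec (m : 'cV[int]_k) : 'cV[R]_k := map_mx intr m.

End torus.

Section torus_map.
Variables (R : realType) (d1 d2 : nat) (A : 'M[int]_(d2, d1)).

(* repr picks some representative of the class; the result does not depend on
   which one, by torus_map_to_torus. *)
Definition torus_map (x : torus R d1) : torus R d2 :=
  to_torus (map_mx intr A *m repr x).

Lemma torus_map_to_torus (x : 'cV[R]_d1) :
  torus_map (to_torus x) = to_torus (map_mx intr A *m x).
Proof.
apply/to_torusP; rewrite -mulmxBr.
have /mxOverP h : int_lattice (repr (to_torus x) - x).
  by apply/to_torusP; exact: reprK.
apply/mxOverP => i j; rewrite mxE rpred_sum// => l _.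
by rewrite rpredM// mxE intr_int.
Qed.

Lemma torus_map_continuous : continuous torus_map.
Proof.
apply/quotient_continuous.
have -> : torus_map \o \pi_(torus R d1) =
    @to_torus R d2 \o mulmx (map_mx intr A).
  by apply/funext => x /=; exact: torus_map_to_torus.
move=> x; apply: continuous_comp; last exact: pi_continuous.
apply: mx_continuous => i j.
under eq_fun do rewrite mxE.
apply: continuous_big => [|l _ y]; first exact: add_continuous.
by apply: continuous_comp; [exact: coord_continuous | exact: mulrl_continuous].
Qed.

Definition torus_hom : {mfun borel (torus R d1) >-> borel (torus R d2)} :=
  HB.pack_for {mfun borel (torus R d1) >-> borel (torus R d2)} torus_map
    (isMeasurableFun.Build _ _ (borel (torus R d1)) (borel (torus R d2))
      torus_map (continuous_borel_measurable torus_map_continuous)).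

End torus_map.

Arguments torus_map R {d1 d2} A.
Arguments torus_hom R {d1 d2} A.
Arguments int_vec R {k} m.

(* Main.v *)
(** Haar measures and their images are analysed through the waves
    x |-> cos (2 pi <l, x> + a), l an integer vector.  The integral of a wave
    against lambda_U is cos a if l is orthogonal to U and 0 otherwise, so the
    wave integrals of (gamma_n)_* lambda_U are 0 or cos a, and their convergence
    means that for each m the condition "gamma_n^t m in U^perp" is eventually
    constant in n.  The m for which it eventually holds form a subgroup of Z^d2
    that is stable under division, hence (Smith normal form) the set of integer
    vectors orthogonal to a rational subspace V; as waves determine a measure,
    mu = lambda_V.  Mixing is asymptotic independence of the waves m o gamma_n
    from each wave l, that is, gamma_n^t m + l is eventually not in U^perp for l
    not in U^perp; it passes to all absolutely continuous measures because
    trigonometric polynomials are dense in L^1(lambda_U).  The converse follows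
    by testing mixing on the density 1 + cos (2 pi <k, x>). *)

From HB Require Import structures.
Require Import Defs.
From mathcomp Require Import all_boot all_order all_algebra.
From mathcomp Require Import archimedean ring lra zify.
From mathcomp Require Import all_classical all_reals all_analysis.
From mathcomp Require Import measurable_realfun.

Import Order.TTheory GRing.Theory Num.Theory.
Import numFieldNormedType.Exports.

Set Implicit Arguments.
Unset Strict Implicit.
Unset Printing Implicit Defensive.

Local Open Scope classical_set_scope.
Local Open Scope ring_scope.

(** Real cosines with a free phase take the place of complex characters: integrals stay real, a
    translation only changes the phase, and the product-to-sum formula keeps linear combinations of
    waves closed under multiplication. In the first claim the obstacle is connectedness, since a
    closed subgroup of the torus may well be disconnected. What excludes it is that U^perp is a real
    subspace: if gamma_n^t (z m) lies in it with z nonzero, so does gamma_n^t m. Rationality is used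
    mainly through an integral unimodular change of coordinates that turns the subspace into a
    coordinate subspace. The subtorus is then the zero set of a nonnegative trigonometric
    polynomial, so it is Borel, and whether a measure is carried by it can be read off from wave
    integrals. In the second claim, the product of the waves of frequencies gamma_n^t m and l only
    involves gamma_n^t m + l and gamma_n^t m - l, so resonances are the only possible obstruction to
    independence. *)

Section cosine.
Context {R : realType}.
Implicit Types t a b : R.

Lemma cosD_2pi_int t a : t \is a Num.int -> cos (a + pi *+ 2 * t) = cos a.
Proof.
have per (n : nat) b : cos (b + pi *+ 2 * n%:R) = cos b.
  by rewrite mulr_natr; exact/periodicn/cosD2pi.
move=> /intrP[[n|n] ->]; first exact: per.
by rewrite NegzE mulrNz mulrN -(per n.+1 (a - _)) subrK.
Qed.

(** Half-angle formula on the fractional part [s]: the hypothesis makes [sin (pi * s)] vanish, while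
    the sine has no zero strictly between 0 and [pi]. *)
Lemma cos_2pi_eq1 t : cos (pi *+ 2 * t) = 1 -> t \is a Num.int.
Proof.
set s := t - (Num.floor t)%:~R => ct1.
have s01 : 0 <= s < 1.
  rewrite /s subr_ge0 ltrBlDl -[1 in X in _ && X]/(1%:~R) -intrD.
  by rewrite floor_le floorD1_gt.
have cs1 : cos (pi *+ 2 * s) = 1.
  by rewrite /s mulrBr -mulrN cosD_2pi_int// rpredN intr_int.
suff s0 : s = 0 by rewrite -(subrK (Num.floor t)%:~R t) -/s s0 add0r intr_int.
have sin0 : sin (pi * s) = 0.
  have : sin (pi * s) ^+ 2 = 0.
    by move: cs1; rewrite mulrnAl cos_mulr2n sin2cos2; lra.
  by move/eqP; rewrite sqrf_eq0 => /eqP.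
case/andP: s01; rewrite le_eqVlt => /predU1P[//|s_gt0 s_lt1].
have := @sin_gt0_pi R (pi * s).
by rewrite sin0 ltxx mulr_gt0 ?pi_gt0//= gtr_pMr ?pi_gt0// => /(_ s_lt1).
Qed.

Lemma cosM a b : cos a * cos b = (cos (a + b) + cos (a - b)) / 2.
Proof. by rewrite cosB cosD; lra. Qed.

End cosine.

(** * Inner products and integer vectors *)

Section dot_product.
Context {R : realType} {k : nat}.
Implicit Types (u v w : 'cV[R]_k) (l m : 'cV[int]_k).

Lemma dotC u v : dot u v = dot v u.
Proof. by apply: eq_bigr => i _; rewrite mulrC. Qed.

Lemma dotDl u v w : dot (u + v) w = dot u w + dot v w.
Proof. by rewrite -big_split/=; apply: eq_bigr => i _; rewrite mxE mulrDl. Qed.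

Lemma dotDr u v w : dot u (v + w) = dot u v + dot u w.
Proof. by rewrite dotC dotDl !(dotC _ u). Qed.

Lemma dotZl a u v : dot (a *: u) v = a * dot u v.
Proof. by rewrite mulr_sumr; apply: eq_bigr => i _; rewrite mxE mulrA. Qed.

Lemma dotZr a u v : dot u (a *: v) = a * dot u v.
Proof. by rewrite dotC dotZl dotC. Qed.

Lemma dotNl u v : dot (- u) v = - dot u v.
Proof. by rewrite -scaleN1r dotZl mulN1r. Qed.

Lemma dot_mx u v : dot u v = (u^T *m v) 0 0.
Proof. by rewrite mxE; apply: eq_bigr => i _; rewrite mxE. Qed.

Lemma dot_eq0 u : (dot u u == 0) = (u == 0).
Proof.
apply/idP/eqP => [|->]; last by rewrite dot_mx mulmx0 mxE.
rewrite psumr_eq0 => [/allP u0|i _]; last by rewrite -expr2 sqr_ge0.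
apply/matrixP => i j; rewrite ord1 mxE.
by have := u0 i (mem_index_enum i); rewrite -expr2 sqrf_eq0 => /eqP.
Qed.

Lemma dot_delta i v : dot (int_vec R (delta_mx i 0)) v = v i 0.
Proof.
rewrite /dot (bigD1 i)//= big1 ?addr0 => [|j ji].
  by rewrite !mxE !eqxx mul1r.
by rewrite !mxE (negbTE ji) mul0r.
Qed.

Lemma int_vecD l m : int_vec R (l + m) = int_vec R l + int_vec R m.
Proof. exact: map_mxD. Qed.

Lemma int_vecN l : int_vec R (- l) = - int_vec R l.
Proof. exact: map_mxN. Qed.

Lemma int_vecB l m : int_vec R (l - m) = int_vec R l - int_vec R m.
Proof. exact: map_mxB. Qed.

Lemma int_vecZ z l : int_vec R (z *: l) = z%:~R *: int_vec R l.
Proof. exact: map_mxZ. Qed.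

Lemma int_vec0 : int_vec R (0 : 'cV_k) = 0.
Proof. exact: map_mx0. Qed.

Lemma int_vec_eq0 l : (int_vec R l == 0) = (l == 0).
Proof.
apply/eqP/eqP => [/matrixP l0|->]; last exact: int_vec0.
apply/matrixP => i j; have := l0 i j; rewrite !mxE => /eqP.
by rewrite intr_eq0 => /eqP.
Qed.

Lemma int_lattice_int_vec l : int_lattice (int_vec R l).
Proof. by apply/mxOverP => i j; rewrite mxE intr_int. Qed.

Lemma int_latticeP v : reflect (exists l, v = int_vec R l) (int_lattice v).
Proof.
apply: (iffP idP) => [/mxOverP vZ|[l ->]]; last exact: int_lattice_int_vec.
exists (\matrix_(i, j) Num.floor (v i j)); apply/matrixP => i j.
by rewrite !mxE (floorK (vZ i j)).
Qed.

Lemma dot_int l v : int_lattice v -> dot (int_vec R l) v \is a Num.int.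
Proof.
move=> /mxOverP vZ; apply: rpred_sum => i _.
by rewrite mxE rpredM ?intr_int.
Qed.

End dot_product.

Lemma dot_trmx {R : realType} {d1 d2 : nat} (A : 'M[int]_(d2, d1))
    (m : 'cV[int]_d2) (x : 'cV[R]_d1) :
  dot (int_vec R (A^T *m m)) x = dot (int_vec R m) (map_mx intr A *m x).
Proof.
by rewrite !dot_mx /int_vec map_mxM trmx_mul -(map_trmx _ A) trmxK mulmxA.
Qed.

(** * Waves and trigonometric polynomials on the torus *)

(** The phase lets one family contain both the real and the imaginary part of the character of
    frequency [l]. The choice made by [repr] is harmless because [l] is integral, see
    [wave_to_torus]. *)
Definition wave {R : realType} {k : nat} (l : 'cV[int]_k) (a : R)
    (x : torus R k) : R :=
  cos (pi *+ 2 * dot (int_vec R l) (repr x) + a).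

Section wave.
Context {R : realType} {k : nat}.
Implicit Types (l m : 'cV[int]_k) (a b : R) (v : 'cV[R]_k) (x : torus R k).

Lemma to_torus_repr x : to_torus (repr x) = x.
Proof. exact: reprK. Qed.

Lemma wave_to_torus l a v :
  wave l a (to_torus v) = cos (pi *+ 2 * dot (int_vec R l) v + a).
Proof.
rewrite /wave -(subrK v (repr _)) dotDr mulrDr -addrA addrC.
apply: cosD_2pi_int; apply: dot_int; apply/to_torusP; exact: to_torus_repr.
Qed.

Lemma dot_continuous u : continuous (dot u : 'cV[R]_k -> R).
Proof.
move=> x; apply: continuous_big => [|l _ y]; first exact: add_continuous.
apply: (@continuous_comp 'cV[R]_k R R (fun v => v l 0) ( *%R (u l 0))).
  exact: coord_continuous.
exact: mulrl_continuous.
Qed.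

Lemma wave_continuous l a : continuous (wave l a).
Proof.
apply/quotient_continuous.
have -> : wave l a \o \pi_(torus R k)%qT =
    (fun t => cos (pi *+ 2 * t + a)) \o dot (int_vec R l).
  by apply/funext => v; exact: wave_to_torus.
move=> v; apply: continuous_comp; first exact: dot_continuous.
apply: (@continuous_comp _ _ _ (fun t => pi *+ 2 * t + a) (@cos R)).
  by apply: cvgD; [exact: mulrl_continuous | exact: cvg_cst].
exact: continuous_cos.
Qed.

Lemma wave_le1 l a x : `|wave l a x| <= 1.
Proof. exact: cos_max. Qed.

Lemma waveM l m a b x :
  wave l a x * wave m b x =
  (wave (l + m) (a + b) x + wave (l - m) (a - b) x) / 2.
Proof.
rewrite /wave cosM int_vecD int_vecB !dotDl dotNl.
by congr ((cos _ + cos _) / 2); ring.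
Qed.

Lemma wave_shift l a x v :
  wave l a (x + to_torus v) = wave l (a + pi *+ 2 * dot (int_vec R l) v) x.
Proof.
rewrite -(to_torus_repr x) -to_torusD !wave_to_torus dotDr; congr cos; ring.
Qed.

Lemma wave0 a x : wave 0 a x = cos a.
Proof. by rewrite /wave int_vec0 dot_mx trmx0 mul0mx mxE mulr0 add0r. Qed.

Lemma waveDpi l a x : wave l (a + pi) x = - wave l a x.
Proof. by rewrite /wave addrA cosDpi. Qed.

End wave.

(** Origin of the transpose in the criterion: pulling back along [A] acts on frequencies by
    [A^T]. *)
Lemma wave_torus_map {R : realType} {d1 d2 : nat} (A : 'M[int]_(d2, d1))
    (m : 'cV[int]_d2) (a : R) (x : torus R d1) :
  wave m a (torus_map R A x) = wave (A^T *m m) a x.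
Proof.
by rewrite -(to_torus_repr x) torus_map_to_torus !wave_to_torus dot_trmx.
Qed.

(** Generated by linear operations only, so that any linear statement about trigonometric
    polynomials follows from its case for waves by induction; closure under products is then
    derived. *)
Inductive trig {R : realType} {k : nat} : (torus R k -> R) -> Prop :=
| trig_wave l a : trig (wave l a)
| trigD f g : trig f -> trig g -> trig (fun x => f x + g x)
| trigZ c f : trig f -> trig (fun x => c * f x).

Section trig.
Context {R : realType} {k : nat}.
Implicit Types (f g : torus R k -> R).

Lemma trig_cst c : trig (fun _ : torus R k => c).
Proof.
have -> : (fun _ : torus R k => c) = fun x => c * wave 0 0 x.
  by apply/funext => x; rewrite wave0 cos0 mulr1.
exact/trigZ/trig_wave.
Qed.

Lemma trigM f g : trig f -> trig g -> trig (fun x => f x * g x).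
Proof.
move=> tf; elim: tf g => {f} [l a|f1 f2 _ IH1 _ IH2|c f _ IH] g tg.
- elim: tg => {g} [m b|g1 g2 _ IH1 _ IH2|c g _ IH].
  + under eq_fun do rewrite waveM mulrC.
    by apply/trigZ/trigD; exact: trig_wave.
  + by under eq_fun do rewrite mulrDr; exact: trigD.
  + by under eq_fun do rewrite mulrCA; exact: trigZ.
- by under eq_fun do rewrite mulrDl; apply: trigD; [exact: IH1 | exact: IH2].
- by under eq_fun do rewrite -mulrA; exact/trigZ/IH.
Qed.

Lemma trigX f n : trig f -> trig (fun x => f x ^+ n).
Proof.
move=> tf; elim: n => [|n IH]; first exact: trig_cst.
by under eq_fun do rewrite exprS; exact: trigM.
Qed.

Lemma trig_sum (I : Type) (r : seq I) (F : I -> torus R k -> R) :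
  (forall i, trig (F i)) -> trig (fun x => \sum_(i <- r) F i x).
Proof.
move=> tF; elim: r => [|i r IH].
  by under eq_fun do rewrite big_nil; exact: trig_cst.
by under eq_fun do rewrite big_cons; exact: trigD.
Qed.

Lemma trig_prod (I : Type) (r : seq I) (F : I -> torus R k -> R) :
  (forall i, trig (F i)) -> trig (fun x => \prod_(i <- r) F i x).
Proof.
move=> tF; elim: r => [|i r IH].
  by under eq_fun do rewrite big_nil; exact: trig_cst.
by under eq_fun do rewrite big_cons; exact: trigM.
Qed.

Lemma trig_continuous f : trig f -> continuous f.
Proof.
elim=> {f} [l a|f g _ cf _ cg|c f _ cf] x; first exact: wave_continuous.
  exact: (continuousD (@cf x) (@cg x)).
exact: (@continuousM R _ (fun=> c) f x (@cst_continuous _ _ c x) (@cf x)).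
Qed.

End trig.

(** * Uniform density of trigonometric polynomials *)

(** This is cos(pi t)^2. Up to normalisation its N-th power is the de la Vallee Poussin kernel, a
    nonnegative trigonometric polynomial of degree N that concentrates at the integers. *)
Definition kappa {R : realType} (t : R) : R := (1 + cos (pi *+ 2 * t)) / 2.

Section discrete_kernel.
Context {R : realType}.
Implicit Types (t : R).

Lemma kappa_ge0 t : 0 <= kappa t.
Proof. by rewrite divr_ge0// -lerBlDl add0r cos_geN1. Qed.

Lemma sum_cos_grid (L m : nat) t : (m < L)%N ->
  \sum_(j < L) cos (pi *+ 2 * (m%:R * (t - j%:R / L%:R))) = (L * (m == 0))%:R.
Proof.
case: m => [|m] mL.
  rewrite muln1; under eq_bigr do rewrite mul0r mulr0 cos0.
  by rewrite sumr_const card_ord.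
have L0 : L%:R != 0 :> R by rewrite pnatr_eq0; lia.
rewrite muln0; pose a : R := pi * (m.+1%:R / L%:R).
have a0 : sin a != 0.
  rewrite gt_eqF// sin_gt0_pi// mulr_gt0 ?pi_gt0 ?divr_gt0 ?ltr0n//=; try lia.
  by rewrite gtr_pMr ?pi_gt0// ltr_pdivrMr ?mul1r ?ltr_nat ?ltr0n; lia.
(* [a] is half the step between successive angles: multiplied by [sin a], each cosine becomes a
   difference of sines at half steps. The sum telescopes over [m.+1] full periods, and [sin a] is
   nonzero since the frequency is below [L]. *)
pose S (j : nat) := sin (pi *+ 2 * m.+1%:R * t + a - (a *+ 2) * j%:R).
apply: (mulfI a0); rewrite mulr0 mulr_sumr.
have -> : \sum_(j < L) sin a * cos (pi *+ 2 * (m.+1%:R * (t - j%:R / L%:R))) =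
    \sum_(j < L) (- (1/2)) * (S j.+1 - S j).
  apply: eq_bigr => j _; rewrite /S.
  set b := pi *+ 2 * (m.+1%:R * _).
  have -> : pi *+ 2 * m.+1%:R * t + a - a *+ 2 * j.+1%:R = b - a.
    by rewrite /b /a -[in LHS]natr1; field.
  have -> : pi *+ 2 * m.+1%:R * t + a - a *+ 2 * j%:R = b + a.
    by rewrite /b /a; field.
  by rewrite sinB sinD; lra.
rewrite -mulr_sumr -(big_mkord xpredT (fun j => S j.+1 - S j)) telescope_sumr//.
suff -> : S L = S 0%N by rewrite subrr mulr0.
rewrite /S mulr0 subr0 -[LHS](periodicn (@sinD2pi R) m.+1); congr sin.
by rewrite /a -[in LHS](mulr_natr (pi *+ 2)); field.
Qed.

(** The Fourier coefficients of cos(pi t)^(2N) are C(2N, N+m) / 4^N, and no aliasing occurs on a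
    grid of more than N+m points. Multiplication by [kappa] averages neighbouring frequencies with
    weights 1/4, 1/2, 1/4, which is Pascal's rule applied twice. *)
Lemma sum_kappa_cos_grid (N L m : nat) t : (N + m < L)%N ->
  \sum_(j < L) kappa (t - j%:R / L%:R) ^+ N *
      cos (pi *+ 2 * (m%:R * (t - j%:R / L%:R))) =
  L%:R * 'C(N.*2, N + m)%:R / 4 ^+ N.
Proof.
elim: N m => [|N IH] m NmL.
  under eq_bigr do rewrite expr0 mul1r.
  rewrite sum_cos_grid// expr0 divr1 natrM add0n.
  by case: m {NmL} => [|m]; rewrite ?bin0// bin0n.
have half (n : nat) t' : kappa t' * cos (pi *+ 2 * (n.+1%:R * t')) =
    cos (pi *+ 2 * (n.+1%:R * t')) / 2 +
    (cos (pi *+ 2 * (n.+2%:R * t')) + cos (pi *+ 2 * (n%:R * t'))) / 4.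
  rewrite /kappa mulrAC mulrDl mul1r cosM.
  have -> : pi *+ 2 * t' + pi *+ 2 * (n.+1%:R * t') = pi *+ 2 * (n.+2%:R * t').
    by rewrite -[n.+2%:R]natr1; ring.
  have -> : pi *+ 2 * t' - pi *+ 2 * (n.+1%:R * t') = - (pi *+ 2 * (n%:R * t')).
    by rewrite -[n.+1%:R]natr1; ring.
  by rewrite cosN; field.
(* Frequency 0 is separate: its lower neighbour -1 folds onto 1, which corresponds to the symmetry
   of the central binomial coefficients. *)
case: m NmL => [|m] NmL.
  under eq_bigr do rewrite mul0r mulr0 cos0 mulr1 exprSr.
  transitivity (\sum_(j < L) (kappa (t - j%:R / L%:R) ^+ N *
      cos (pi *+ 2 * (0%:R * (t - j%:R / L%:R))) / 2 +
      kappa (t - j%:R / L%:R) ^+ N *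
      cos (pi *+ 2 * (1%:R * (t - j%:R / L%:R))) / 2)).
    apply: eq_bigr => j _; rewrite mul0r mulr0 cos0 mul1r /kappa; ring.
  rewrite big_split/= -!mulr_suml !IH; try lia.
  have -> : 'C(N.+1.*2, N.+1 + 0) = (2 * ('C(N.*2, N + 0) + 'C(N.*2, N + 1)))%N.
    rewrite doubleS !addn0 addn1 binS.
    have -> : 'C(N.*2.+1, N.+1) = 'C(N.*2.+1, N).
      by rewrite -bin_sub; [congr 'C(_, _); lia | lia].
    rewrite -(@bin_sub _ N); last lia.
    have -> : (N.*2.+1 - N)%N = N.+1 by lia.
    by rewrite binS; lia.
  rewrite natrM natrD exprS; have : 4 ^+ N != 0 :> R by rewrite expf_neq0.
  by move=> ?; field.
transitivity (\sum_(j < L) (kappa (t - j%:R / L%:R) ^+ N *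
      cos (pi *+ 2 * (m.+1%:R * (t - j%:R / L%:R))) / 2 +
      (kappa (t - j%:R / L%:R) ^+ N *
      cos (pi *+ 2 * (m.+2%:R * (t - j%:R / L%:R))) / 4 +
      kappa (t - j%:R / L%:R) ^+ N *
      cos (pi *+ 2 * (m%:R * (t - j%:R / L%:R))) / 4))).
  by apply: eq_bigr => j _; rewrite exprSr -mulrA half; ring.
rewrite !big_split/= -!mulr_suml !IH; try lia.
have -> : 'C(N.+1.*2, N.+1 + m.+1) =
    (2 * 'C(N.*2, N + m.+1) + 'C(N.*2, N + m.+2) + 'C(N.*2, N + m))%N.
  by rewrite doubleS !addSn !addnS !binS; lia.
rewrite 2!natrD natrM exprS; have : 4 ^+ N != 0 :> R by rewrite expf_neq0.
by move=> ?; field.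
Qed.

Lemma sum_kappa_grid_gt0 (N L : nat) t : (N < L)%N ->
  0 < \sum_(j < L) kappa (t - j%:R / L%:R) ^+ N.
Proof.
move=> NL; have := @sum_kappa_cos_grid N L 0 t.
rewrite addn0 => /(_ NL); under eq_bigr do rewrite mul0r mulr0 cos0 mulr1.
move=> ->; rewrite divr_gt0 ?exprn_gt0 ?mulr_gt0 ?ltr0n ?bin_gt0//; lia.
Qed.

Lemma sum_kappa_grid_cst (N L : nat) s t : (N < L)%N ->
  \sum_(j < L) kappa (s - j%:R / L%:R) ^+ N =
  \sum_(j < L) kappa (t - j%:R / L%:R) ^+ N.
Proof.
move=> NL; have e r := @sum_kappa_cos_grid N L 0 r.
have {}e (r : R) : \sum_(j < L) kappa (r - j%:R / L%:R) ^+ N =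
    L%:R * 'C(N.*2, N + 0)%:R / 4 ^+ N.
  rewrite -(e r) ?addn0//; apply: eq_bigr => j _.
  by rewrite mul0r mulr0 cos0 mulr1.
by rewrite !e.
Qed.

(* [(N+1) C(2N, N+1) = N C(2N, N)], so the first cosine moment of the kernel is
   [N/(N+1)] of its mass. *)
Lemma sum_kappa_grid_spread (N L : nat) t : (N.+1 < L)%N ->
  \sum_(j < L) kappa (t - j%:R / L%:R) ^+ N *
      (1 - cos (pi *+ 2 * (t - j%:R / L%:R))) =
  (\sum_(j < L) kappa (t - j%:R / L%:R) ^+ N) / N.+1%:R.
Proof.
move=> NL.
have e0 : \sum_(j < L) kappa (t - j%:R / L%:R) ^+ N =
    L%:R * 'C(N.*2, N + 0)%:R / 4 ^+ N.
  rewrite -(@sum_kappa_cos_grid N L 0 t); last lia.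
  by apply: eq_bigr => j _; rewrite mul0r mulr0 cos0 mulr1.
have e1 : \sum_(j < L) kappa (t - j%:R / L%:R) ^+ N *
    cos (pi *+ 2 * (t - j%:R / L%:R)) = L%:R * 'C(N.*2, N + 1)%:R / 4 ^+ N.
  rewrite -(@sum_kappa_cos_grid N L 1 t); last lia.
  by apply: eq_bigr => j _; rewrite mul1r.
under eq_bigr do rewrite mulrBr mulr1.
rewrite sumrB e1 e0 addn0 addn1.
have : (N.+1%:R * 'C(N.*2, N.+1)%:R = N%:R * 'C(N.*2, N)%:R :> R).
  by rewrite -!natrM mul_bin_left; congr (_ * _)%:R; lia.
have N0 : N.+1%:R != 0 :> R by rewrite pnatr_eq0.
have F0 : 4 ^+ N != 0 :> R by rewrite expf_neq0.
move=> e; apply: (mulfI N0).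
transitivity ((N.+1%:R * 'C(N.*2, N)%:R - N.+1%:R * 'C(N.*2, N.+1)%:R) *
    (L%:R / 4 ^+ N) : R); first by field.
rewrite e [RHS]mulrC divfK// -mulrBl -natr1 addrAC subrr add0r mul1r.
by rewrite mulrCA mulrA.
Qed.

End discrete_kernel.

Section uniform_density.
Context {R : realType} {k : nat}.
Implicit Types (f : torus R k -> R) (u v : 'cV[R]_k).

Lemma unit_cube_compact :
  compact [set v : 'cV[R]_k | forall i, v i 0 \in `[0, 1]].
Proof.
have -> : [set v : 'cV[R]_k | forall i, v i 0 \in `[0, 1]] =
    trmx @` [set v : 'rV[R]_k | forall i, `[0, 1]%classic (v ord0 i)].
  apply/seteqP; split=> [v v01|_ [v v01 <-] i]; last by rewrite mxE; exact: v01.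
  by exists v^T; [move=> i; rewrite /= mxE; exact: v01 | exact: trmxK].
apply: continuous_compact.
  apply: continuous_subspaceT; apply: mx_continuous => i j.
  rewrite (_ : (fun x : 'rV[R]_k => x^T i j) = (fun x => x j i)).
    exact: coord_continuous.
  by apply/funext => x; rewrite mxE.
apply: (@rV_compact R k (fun=> `[0, 1]%classic)) => _; exact: segment_compact.
Qed.

Lemma to_torusBint v (z : 'cV[int]_k) :
  to_torus (v - int_vec R z) = to_torus v.
Proof.
apply/to_torusP; rewrite addrAC subrr add0r -int_vecN.
exact: int_lattice_int_vec.
Qed.

Definition floor_vec v : 'cV[int]_k := \col_i Num.floor (v i 0).

Lemma sub_floor_unit_cube v i : (v - int_vec R (floor_vec v)) i 0 \in `[0, 1].
Proof.
rewrite !mxE in_itv/= subr_ge0 floor_le/= lerBlDl -[X in _ + X]/(1%:~R).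
by rewrite -intrD ltW// floorD1_gt.
Qed.

Lemma to_torus_continuous : continuous (@to_torus R k).
Proof. exact: pi_continuous. Qed.

(** Compactness is used on the unit cube, which meets every class, through the lift of [f] to column
    vectors. *)
Lemma torus_bounded f : continuous f -> exists M : R, forall x, `|f x| <= M.
Proof.
move=> cf.
have cF : continuous (f \o @to_torus R k).
  by move=> v; apply: continuous_comp; [exact: to_torus_continuous | exact: cf].
have /compact_near_coveringP cov := unit_cube_compact.
have [|M [_ bM]] := cov R +oo (fun M v => `|f (to_torus v)| <= M) _.
  move=> v _; exists ([set w | `|f (to_torus v) - f (to_torus w)| < 1],
      [set M | `|f (to_torus v)| + 1 <= M]).
    split; first by have /cvgrPdist_lt/(_ _ ltr01) := cF v.
    by apply: nbhs_pinfty_ge; rewrite num_real.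
  move=> [w M] [/= vw]; apply: le_trans.
  rewrite -(subrK (f (to_torus v)) (f (to_torus w))).
  by rewrite (le_trans (ler_normD _ _))// addrC lerD2l ltW// distrC.
exists (M + 1) => x.
rewrite -(to_torus_repr x) -(to_torusBint _ (floor_vec (repr x))).
by apply: (bM (M + 1)) => [|i]; [rewrite ltrDl | exact: sub_floor_unit_cube].
Qed.

Lemma torus_unif_continuous f (e : R) : continuous f -> 0 < e ->
  exists2 d : R, 0 < d < 1 / 2 & forall u v : 'cV[R]_k,
    (forall i, `|u i 0 - v i 0| < d) ->
    `|f (to_torus u) - f (to_torus v)| < e.
Proof.
move=> cf e0; have e20 : 0 < e / 2 by rewrite divr_gt0.
have cF : continuous (f \o @to_torus R k).
  by move=> v; apply: continuous_comp; [exact: to_torus_continuous | exact: cf].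
have /compact_near_coveringP cov := unit_cube_compact.
pose P (d : R) u := forall v : 'cV[R]_k, (forall i, `|u i 0 - v i 0| < d) ->
    `|f (to_torus u) - f (to_torus v)| < e.
have nP : \forall d \near 0^'+,
    [set v : 'cV[R]_k | forall i, v i 0 \in `[0, 1]] `<=` P d.
  apply: cov => u _.
  have /cvgrPdist_lt/(_ _ e20) := cF u.
  rewrite -nbhs_ballE => -[r /= r0 ru].
  exists (ball u (r / 2), [set d : R | d < r / 2]).
    split; first by apply: nbhsx_ballx; rewrite divr_gt0.
    by apply: nbhs_right_lt; rewrite divr_gt0.
  move=> [w d] [/= [_ uw] dr] v wv.
  rewrite -(subrK (f (to_torus u)) (f (to_torus w))) -addrA.
  rewrite (splitr e) (le_lt_trans (ler_normD _ _))// ltrD//.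
    rewrite distrC; apply: ru; split=> // i j; rewrite /ball/=.
    by rewrite (lt_trans (uw i j))// ltr_pdivrMr// ltr_pMr// ltr1n.
  apply: ru; split=> // i j; rewrite ord1 /ball/=.
  rewrite -(subrK (w i 0) (u i 0)) -addrA (le_lt_trans (ler_normD _ _))//.
  by rewrite (splitr r) ltrD//; [exact: uw | exact: lt_trans (wv i) dr].
have : \forall d \near 0^'+, 0 < d < 1 / 2 /\
    [set v : 'cV[R]_k | forall i, v i 0 \in `[0, 1]] `<=` P d.
  near=> d; split; last by near: d.
  by apply/andP; split; near: d; [exact: nbhs_right_gt | exact: nbhs_right_lt].
move=> /(@filter_ex _ _ _)[d [d0 dP]]; exists d => // u v uv.
(* The same integer vector is subtracted from both points: [u] enters the cube, and [v] may stay
   outside but keeps its distance to [u]. *)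
rewrite -(to_torusBint u (floor_vec u)) -(to_torusBint v (floor_vec u)).
apply: dP => [i|i]; first exact: sub_floor_unit_cube.
  rewrite (_ : _ - _ = u i 0 - v i 0); [exact: uv | by rewrite !mxE; ring].
Unshelve. all: by end_near.
Qed.

(** The cosine defect detects distance modulo integers: cos(2 pi t) decreases on [0, 1/2], so a
    coordinate at distance at least [d] from the integers contributes at least 1 - cos(2 pi d). *)
Lemma torus_cos_gap (d : R) : 0 < d < 1 / 2 ->
  exists2 g : R, 0 < g & forall u v : 'cV[R]_k,
    (exists z, forall i, `|(u - int_vec R z) i 0 - v i 0| < d) \/
    g <= \sum_(i < k) (1 - cos (pi *+ 2 * (u i 0 - v i 0))).
Proof.
move=> /andP[d0 d2]; have pi0 := @pi_gt0 R.
have pi20 : 0 < pi *+ 2 :> R by rewrite pmulrn_lgt0.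
have in0pi (r : R) : 0 <= r <= 1 / 2 -> pi *+ 2 * r \in `[0, pi].
  move=> /andP[r0 r2]; rewrite in_itv/=; apply/andP; split.
    by apply: mulr_ge0 => //; exact: ltW.
  by rewrite -mulr_natr -mulrA ger_pMr//; lra.
exists (1 - cos (pi *+ 2 * d)) => [|u v].
  rewrite subr_gt0 -cos0 -(mulr0 (pi *+ 2)) ltr_cos; last 2 first.
  - by apply: in0pi; lra.
  - by apply: in0pi; lra.
  by rewrite ltr_pM2l.
(* Adding 1/2 before taking the floor gives a nearest integer, so the remainder [t] stays in
   [-1/2, 1/2]. *)
pose z : 'cV[int]_k := \col_i Num.floor (u i 0 - v i 0 + 1 / 2).
pose t i := u i 0 - v i 0 - (z i 0)%:~R.
have t2 i : `|t i| <= 1 / 2.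
  rewrite /t mxE; set s := u i 0 - v i 0.
  have := floor_le (s + 1 / 2); have := floorD1_gt (s + 1 / 2).
  by rewrite intrD ler_norml; lra.
have ct i : cos (pi *+ 2 * (u i 0 - v i 0)) = cos (pi *+ 2 * `|t i|).
  rewrite -[in RHS](gtr0_norm pi20) -normrM cos_norm /t.
  by rewrite [in RHS]mulrBr -[in RHS]mulrN cosD_2pi_int// rpredN intr_int.
have [near_uv|/existsNP[i /negP]] := pselect (forall i, `|t i| < d).
  left; exists z => i; rewrite (_ : _ - v i 0 = t i)//.
  by rewrite /t !mxE addrAC.
rewrite -leNgt => dti; right.
rewrite (bigD1 i)//= -[leLHS]addr0 lerD//; last first.
  by apply: sumr_ge0 => j _; rewrite subr_ge0 cos_le1.
rewrite lerD2l lerN2 ct.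
have := t2 i; have t0 : 0 < `|t i| by exact: lt_le_trans dti.
move: dti; rewrite le_eqVlt => /predU1P[->//|dti] ti.
rewrite ltW// ltr_cos; last 2 first.
- by apply: in0pi; lra.
- by apply: in0pi; lra.
by rewrite ltr_pM2l.
Qed.

(** A modulus of continuity expressed by the first harmonics, the test functions of Korovkin's
    argument. For points that are not close, the constant 2M/g absorbs the trivial bound 2M. *)
Lemma torus_cos_modulus f (e : R) : continuous f -> 0 < e ->
  exists2 C : R, 0 <= C & forall u v : 'cV[R]_k,
    `|f (to_torus u) - f (to_torus v)| <=
      e + C * \sum_(i < k) (1 - cos (pi *+ 2 * (u i 0 - v i 0))).
Proof.
move=> cf e0; have [d d02 fd] := torus_unif_continuous cf e0.
have [M fM] := torus_bounded cf.
have M0 : 0 <= M := le_trans (normr_ge0 _) (fM 0).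
have [g g0 gap] := torus_cos_gap d02.
exists (M *+ 2 / g) => [|u v]; first by rewrite divr_ge0 ?mulrn_wge0// ltW.
have [[z uv]|guv] := gap u v.
  rewrite -(to_torusBint u z); apply: (@le_trans _ _ e); first exact/ltW/fd.
  rewrite lerDl mulr_ge0//; first by rewrite divr_ge0 ?mulrn_wge0// ltW.
  by apply: sumr_ge0 => j _; rewrite subr_ge0 cos_le1.
apply: (@le_trans _ _ (M *+ 2)).
  by rewrite (le_trans (ler_normB _ _))// mulr2n lerD.
rewrite -[leLHS]add0r lerD ?(ltW e0)// mulrAC ler_pdivlMr//.
by rewrite ler_wpM2l ?mulrn_wge0.
Qed.

End uniform_density.

Section trig_density.
Context {R : realType} {k : nat}.
Implicit Types (f : torus R k -> R) (v : 'cV[R]_k).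

Definition coord_kappa (i : 'I_k) (s : R) (x : torus R k) : R :=
  (1 + wave (delta_mx i 0) (- (pi *+ 2 * s)) x) / 2.

Lemma coord_kappaE i s v : coord_kappa i s (to_torus v) = kappa (v i 0 - s).
Proof.
by rewrite /coord_kappa wave_to_torus dot_delta /kappa mulrBr.
Qed.

Lemma trig_coord_kappa i s : trig (coord_kappa i s).
Proof.
rewrite /coord_kappa; under eq_fun do rewrite mulrC.
exact/trigZ/trigD/trig_wave/trig_cst.
Qed.

(* On a grid finer than the degree of the kernel, grid sums do not depend on the
   base point; sampling thus replaces a convolution integral. *)
Section kernel.
Variables (N L : nat) (NL : (N.+1 < L)%N).

Let grid := {ffun 'I_k -> 'I_L}.

Definition grid_point (g : grid) : 'cV[R]_k := \col_i ((g i)%:R / L%:R).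

Definition grid_kernel (g : grid) (x : torus R k) : R :=
  \prod_i coord_kappa i ((g i)%:R / L%:R) x ^+ N.

Lemma trig_grid_kernel g : trig (grid_kernel g).
Proof. by apply: trig_prod => i; exact/trigX/trig_coord_kappa. Qed.

Definition grid_mass : R := \sum_(j < L) kappa (0 - j%:R / L%:R :> R) ^+ N.

Lemma grid_mass_gt0 : 0 < grid_mass.
Proof. by apply: sum_kappa_grid_gt0; lia. Qed.

Lemma grid_kernel_ge0 g x : 0 <= grid_kernel g x.
Proof.
rewrite -(to_torus_repr x); apply: prodr_ge0 => i _.
by rewrite coord_kappaE exprn_ge0// kappa_ge0.
Qed.

Lemma sum_grid_kernel x : \sum_g grid_kernel g x = grid_mass ^+ k.
Proof.
rewrite -(to_torus_repr x) /grid_kernel.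
rewrite -(bigA_distr_bigA (fun i (j : 'I_L) =>
  coord_kappa i (j%:R / L%:R) (to_torus (repr x)) ^+ N)) -[in RHS](card_ord k).
rewrite -prodr_const; apply: eq_bigr => i _.
under eq_bigr do rewrite coord_kappaE.
by apply: sum_kappa_grid_cst; lia.
Qed.

Lemma grid_kernel_spread i v :
  \sum_g grid_kernel g (to_torus v) *
    (1 - cos (pi *+ 2 * (v i 0 - grid_point g i 0))) =
  grid_mass ^+ k / N.+1%:R.
Proof.
(* The summand is a product over coordinates in which only the factor at [i] carries the cosine
   defect, so the grid sum splits into one-dimensional sums. *)
pose F i' (j : 'I_L) := kappa (v i' 0 - j%:R / L%:R) ^+ N *
  (if i' == i then 1 - cos (pi *+ 2 * (v i' 0 - j%:R / L%:R)) else 1).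
transitivity (\sum_(g : grid) \prod_i' F i' (g i')).
  apply: eq_bigr => g _; rewrite big_split/=; congr (_ * _).
    by apply: eq_bigr => i' _; rewrite coord_kappaE.
  rewrite (bigD1 i)//= eqxx big1 ?mulr1 => [|i' /negbTE -> //].
  by rewrite mxE.
rewrite -bigA_distr_bigA (bigD1 i)//= -[in RHS](card_ord k) -prodr_const.
rewrite [in RHS](bigD1 i)//= mulrAC; congr (_ * _).
  under eq_bigr do rewrite /F eqxx.
  rewrite sum_kappa_grid_spread//; congr (_ / _).
  by apply: sum_kappa_grid_cst; lia.
apply: eq_bigr => i' /negbTE i'i.
under eq_bigr do rewrite /F i'i mulr1.
by apply: sum_kappa_grid_cst; lia.
Qed.

Definition grid_approx f (x : torus R k) : R :=
  grid_mass ^- k * \sum_g f (to_torus (grid_point g)) * grid_kernel g x.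

Lemma trig_grid_approx f : trig (grid_approx f).
Proof. by apply/trigZ/trig_sum => g; exact/trigZ/trig_grid_kernel. Qed.

End kernel.

(* Korovkin's argument: a positive operator fixing constants and almost fixing
   the first harmonics is close to the identity. *)
Lemma trig_dense f (e : R) : continuous f -> 0 < e ->
  exists2 g, trig g & forall x, `|f x - g x| <= e.
Proof.
move=> cf e0; have e20 : 0 < e / 2 by rewrite divr_gt0.
have [C C0 fC] := torus_cos_modulus cf e20.
(* The k cosine defects contribute C k / (N+1) in total, which this [N] brings below e/2; [N.+2] is
   the coarsest grid that [grid_kernel_spread] accepts. *)
pose N := Num.bound (C * k%:R / (e / 2)); pose L := N.+2.
have NL : (N.+1 < L)%N by [].
exists (@grid_approx N L f); first exact: trig_grid_approx.
move=> x; rewrite -(to_torus_repr x); move: (repr x) => v {x}.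
pose W g := @grid_kernel N L g (to_torus v); pose O := grid_mass N L ^+ k.
have O0 : 0 < O by rewrite exprn_gt0// grid_mass_gt0.
have sW : \sum_g W g = O by exact: sum_grid_kernel.
have W0 g : 0 <= W g by exact: grid_kernel_ge0.
have -> : f (to_torus v) - @grid_approx N L f (to_torus v) =
    O^-1 * \sum_g W g * (f (to_torus v) - f (to_torus (grid_point g))).
  under eq_bigr do rewrite mulrBr.
  rewrite sumrB -mulr_suml sW mulrBr mulKf ?gt_eqF//.
  by congr (_ - _ * _); apply: eq_bigr => g _; rewrite mulrC.
rewrite normrM gtr0_norm ?invr_gt0// mulrC ler_pdivrMr//.
apply: le_trans (ler_norm_sum _ _ _) _.
apply: (@le_trans _ _ (\sum_g (W g * (e / 2) + C * \sum_i W g *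
    (1 - cos (pi *+ 2 * (v i 0 - grid_point g i 0)))))).
  apply: ler_sum => g _; rewrite normrM ger0_norm//.
  by rewrite -mulr_sumr (mulrCA C) -mulrDr ler_wpM2l.
rewrite big_split/= -mulr_suml sW -mulr_sumr exchange_big/=.
under eq_bigr do rewrite grid_kernel_spread//.
rewrite sumr_const card_ord -/O [leRHS]mulrC {2}(splitr e) mulrDr lerD2l.
rewrite (_ : C * _ = O * (C * k%:R / N.+1%:R)); last first.
  by rewrite -mulr_natr; ring.
rewrite ler_wpM2l ?(ltW O0)//.
have /archi_boundP : 0 <= C * k%:R / (e / 2).
  by rewrite !mulr_ge0// invr_ge0 ltW.
rewrite -/N ltr_pdivrMr// => CN.
rewrite ler_pdivrMr ?ltr0n// (le_trans (ltW CN))//.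
by rewrite mulrC ler_wpM2l ?ler_nat// ltW.
Qed.

End trig_density.

(** * Rational subspaces and subtori *)

Section rational_subspaces.
Context {R : realType} {k : nat}.
Implicit Types (U V : {vspace 'cV[R]_k}) (u v x : 'cV[R]_k) (Q : 'M[int]_k).

Local Notation "A %:RM" := (map_mx intr A : 'M[R]_(_, _))
  (at level 2, format "A %:RM").

Lemma int_lattice_mulmx m n (A : 'M[int]_(m, n)) (y : 'cV[R]_n) :
  int_lattice y -> int_lattice (A%:RM *m y).
Proof.
move=> /mxOverP yZ; apply/mxOverP => i j.
by rewrite mxE; apply: rpred_sum => l _; rewrite rpredM// mxE intr_int.
Qed.

Lemma rational_int_basis U : rational_subspace U ->
  exists r (B : 'M[int]_(k, r)),
    (forall u, u \in U <-> exists c : 'cV[R]_r, u = B%:RM *m c) /\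
    (forall c : 'cV[R]_r, B%:RM *m c = 0 -> c = 0).
Proof.
move=> [b bU bL]; exists (\dim U).
have bZ i : int_lattice (tnth b i).
  suff : [set x | x \in U /\ int_lattice x] (tnth b i) by case.
  rewrite bL /=; exists [ffun j => (j == i)%:R].
  rewrite (bigD1 i)//= big1 => [|j ji]; last by rewrite ffunE (negbTE ji).
  by rewrite addr0 ffunE eqxx (tnth_nth 0).
have /choice[beta betaE] : forall i, exists l, tnth b i = int_vec R l.
  by move=> i; exact/int_latticeP.
pose B : 'M[int]_(k, \dim U) := \matrix_(i, j) beta j i 0.
have BE (c : 'cV[R]_(\dim U)) : B%:RM *m c = \sum_j c j 0 *: b`_j.
  apply/matrixP => i l; rewrite ord1 !mxE summxE; apply: eq_bigr => j _.
  by rewrite -tnth_nth betaE !mxE mulrC.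
exists B; split=> [u|c].
  split=> [uU|[c ->]].
    exists (\col_j coord b j u); rewrite BE [LHS](coord_basis bU uU).
    by apply: eq_bigr => j _; rewrite mxE.
  rewrite BE; apply: memv_suml => j _; apply: memvZ; apply: (basis_mem bU).
  by apply: mem_nth; rewrite size_tuple.
have /freeP fb := basis_free bU.
rewrite BE => /(fb (fun j => c j 0)) c0.
by apply/matrixP => i j; rewrite ord1 mxE c0.
Qed.

(** Write an integer basis matrix in Smith form, B = L D S. In the coordinates [invmx L] the
    subspace is the image of D, that is, the coordinate subspace where the entries facing zero rows
    of D vanish. *)
Lemma rational_unimodular U : rational_subspace U ->
  exists Q (Z : {set 'I_k}), Q \in unitmx /\
    forall u, u \in U <-> forall i, i \in Z -> (Q%:RM *m u) i 0 = 0.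
Proof.
move=> /rational_int_basis[r [B [BU _]]].
have [L Lu [S Su [d _ BE]]] := int_Smith_normal_form B.
pose D := \matrix_(i < k, j < r) (d`_i *+ (i == j :> nat)).
have LK : (invmx L)%:RM *m L%:RM = 1%:M :> 'M[R]_k.
  by rewrite -map_mxM mulVmx// map_mx1.
have SK : S%:RM *m (invmx S)%:RM = 1%:M :> 'M[R]_r.
  by rewrite -map_mxM mulmxV// map_mx1.
have LK' : L%:RM *m (invmx L)%:RM = 1%:M :> 'M[R]_k.
  by rewrite -map_mxM mulmxV// map_mx1.
exists (invmx L), [set i | [forall j, D i j == 0]]%SET.
rewrite unitmx_inv; split=> // u; split.
  move=> /BU[c ->] i; rewrite inE => /forallP D0.
  rewrite BE -/D !map_mxM -!mulmxA mulmxA LK mul1mx mxE big1// => j _.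
  by rewrite mxE (eqP (D0 j)) mul0r.
move=> Qu0; apply/BU; set y := (invmx L)%:RM *m u in Qu0.
suff [c' yE] : exists c' : 'cV[R]_r, y = D%:RM *m c'.
  exists ((invmx S)%:RM *m c'); rewrite BE -/D !map_mxM.
  by rewrite -!mulmxA (mulmxA S%:RM) SK mul1mx -yE mulmxA LK' mul1mx.
move: (y) Qu0 => {}y Qu0.
(* Solves the diagonal system entrywise. [insub] reads the column index as a row index; a column
   beyond the last row of D is zero, hence the default value. *)
exists (\col_j if insub (val j) is Some i then y i 0 / (d`_i)%:~R else 0).
apply/matrixP => i l; rewrite ord1 mxE.
have [iZ|] := boolP (i \in [set i | [forall j, D i j == 0]]%SET).
  rewrite Qu0//; move: iZ; rewrite inE => /forallP D0.
  by rewrite big1// => j _; rewrite [D%:RM i j]mxE (eqP (D0 j)) mul0r.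
rewrite inE negb_forall => /existsP[j]; rewrite mxE.
have [ij|_] := eqVneq (val i) (val j); last by rewrite mulr0n eqxx.
rewrite mulr1n => di0.
rewrite (bigD1 j)//= big1 => [|j' j'j].
  rewrite addr0 !mxE ij eqxx mulr1n.
  rewrite (_ : insub _ = Some i); last by rewrite -ij valK.
  by rewrite -ij mulrC divfK// intr_eq0.
rewrite !mxE ij (_ : _ == _ = false) ?mulr0n ?mul0r//.
by apply: contraNF j'j => /eqP e; apply/eqP/val_inj.
Qed.

Lemma mem_subtorus_unimodular U Q (Z : {set 'I_k}) x : Q \in unitmx ->
  (forall u, u \in U <-> forall i, i \in Z -> (Q%:RM *m u) i 0 = 0) ->
  (forall i, i \in Z -> (Q%:RM *m x) i 0 \is a Num.int) ->
  subtorus U (to_torus x).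
Proof.
move=> Qu UE xZ.
(* Subtracting [invmx Q] applied to [y] cancels the coordinates in [Z]; since [invmx Q] is integral,
   the class of [x] in the torus does not change. *)
pose y : 'cV[R]_k := \col_i if i \in Z then (Q%:RM *m x) i 0 else 0.
have yZ : int_lattice y.
  apply/mxOverP => i j; rewrite mxE.
  by case: ifPn => // iZ; exact: xZ.
exists (x - (invmx Q)%:RM *m y) => /=.
  apply/UE => i iZ; rewrite mulmxBr mulmxA -map_mxM mulmxV// map_mx1 mul1mx.
  by rewrite mxE [X in _ + X]mxE [y i 0]mxE iZ subrr.
apply/to_torusP; rewrite addrAC subrr add0r -mulmxN.
apply: int_lattice_mulmx; apply/mxOverP => i j.
by rewrite mxE rpredN; exact: (mxOverP yZ).
Qed.

(** The tuple length is generalised so that it can replace [\dim V] in the dependent type of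
    [is_lattice_in]. *)
Lemma is_lattice_in_span V m (b : m.-tuple 'cV[R]_k) : basis_of V b ->
  is_lattice_in [set x | inIntSpan b x] V.
Proof.
move=> bV; have mV : m = \dim V by rewrite -(size_basis bV).
by rewrite /is_lattice_in -mV; exists b.
Qed.

(** The columns of [invmx Q] with index outside [Z] serve both as a basis of V and as a lattice
    basis of its integer vectors, because [Q] sends integer vectors to integer coordinates. *)
Lemma rational_of_unimodular Q (Z : {set 'I_k}) : Q \in unitmx ->
  exists V, rational_subspace V /\
    forall u, u \in V <-> forall i, i \in Z -> (Q%:RM *m u) i 0 = 0.
Proof.
move=> Qu; pose P := invmx Q.
have PK : P%:RM *m Q%:RM = 1%:M :> 'M[R]_k.
  by rewrite -map_mxM mulVmx// map_mx1.
have QK : Q%:RM *m P%:RM = 1%:M :> 'M[R]_k.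
  by rewrite -map_mxM mulmxV// map_mx1.
pose m := #|~: Z|%SET.
pose e (j : 'I_m) : 'I_k := enum_val j.
pose b : m.-tuple 'cV[R]_k := [tuple col (e j) P%:RM | j < m].
have bE (j : 'I_m) : b`_j = col (e j) P%:RM by rewrite -tnth_nth tnth_mktuple.
have eZ j : e j \notin Z by have := enum_valP j; rewrite inE.
have Qsum (c : 'I_m -> R) : Q%:RM *m (\sum_j c j *: b`_j) =
    \sum_j c j *: delta_mx (e j) 0.
  rewrite mulmx_sumr; apply: eq_bigr => j _.
  by rewrite bE -scalemxAr colE mulmxA QK mul1mx.
have colsE u : (forall i, i \in Z -> (Q%:RM *m u) i 0 = 0) ->
    u = \sum_j (Q%:RM *m u) (e j) 0 *: b`_j.
  move=> u0; rewrite -[LHS]mul1mx -PK -mulmxA; set y := Q%:RM *m u.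
  transitivity (\sum_i y i 0 *: col i P%:RM).
    apply/matrixP => i l; rewrite ord1 summxE mxE; apply: eq_bigr => j _.
    by rewrite !mxE mulrC.
  rewrite (bigID (fun i => i \in (~: Z)%SET))/=.
  rewrite [X in _ + X]big1 ?addr0 => [|i]; last first.
    by rewrite inE negbK => /u0 ->; rewrite scale0r.
  by rewrite big_enum_val/=; apply: eq_bigr => j _; rewrite bE.
have fb : free b.
  apply/freeP => c /(congr1 (mulmx Q%:RM)); rewrite Qsum mulmx0 => /matrixP c0 j.
  have := c0 (e j) 0; rewrite summxE mxE (bigD1 j)//= big1 => [|j' j'j].
    by rewrite !mxE !eqxx mulr1 addr0.
  by rewrite !mxE (inj_eq enum_val_inj) [j == j']eq_sym (negbTE j'j) mulr0.
pose V := <<b>>%VS.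
have VE u : u \in V <-> forall i, i \in Z -> (Q%:RM *m u) i 0 = 0.
  split=> [uV i iZ|/colsE ->].
    rewrite (coord_span uV) Qsum summxE big1// => j _.
    rewrite !mxE (_ : _ == _ = false) ?mulr0//.
    by apply/negbTE; apply: contraNneq (eZ j) => <-.
  apply: memv_suml => j _; apply: memvZ; apply: memv_span.
  by apply: mem_nth; rewrite size_tuple.
exists V; split=> //.
have bV : basis_of V b by rewrite basisEfree fb subvv/= -(eqP fb).
have bL : [set x | x \in V /\ int_lattice x] = [set x | inIntSpan b x].
  apply/seteqP; split=> x /=.
    move=> [/VE/colsE xE xZ]; have /mxOverP QxZ := int_lattice_mulmx Q xZ.
    exists [ffun j => Num.floor ((Q%:RM *m x) (e j) 0)].
    rewrite [LHS]xE; apply: eq_bigr => j _.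
    by rewrite ffunE -scaler_int floorK.
  move=> [a ->]; split.
    apply: memv_suml => j _; rewrite -scaler_int; apply: memvZ; apply: memv_span.
    by apply: mem_nth; rewrite size_tuple.
  apply/mxOverP => i l; rewrite summxE; apply: rpred_sum => j _.
  by rewrite -scaler_int bE !mxE rpredM ?intr_int.
have mV : m = \dim V by rewrite -[LHS](size_tuple b) (eqP fb).
by rewrite /rational_subspace bL; exact: is_lattice_in_span.
Qed.

(* With [B] an integer basis matrix of [U] and [N] the Gram determinant,
   [B adj(B^T B) B^T l] is [N] times the orthogonal projection of [l] on [U]. *)
Lemma rational_projection U (l : 'cV[int]_k) : rational_subspace U ->
  exists (N : int) (m : 'cV[int]_k), [/\ N != 0, int_vec R m \in U &
    orth U (int_vec R (N *: l - m))].
Proof.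
move=> /rational_int_basis[r [B [BU Binj]]].
pose G := B^T *m B.
exists (\det G), (B *m \adj G *m B^T *m l); split.
- have : \det G%:RM != 0.
    (* A kernel vector [v] of the Gram matrix satisfies |B v^T|^2 = v G v^T = 0, against the
       injectivity of B. *)
    apply/negP => /det0P[v v0 vG]; move/negP: v0; apply.
    suff Bv : B%:RM *m v^T = 0 by rewrite -[v]trmxK (Binj _ Bv) trmx0.
    apply/eqP; rewrite -dot_eq0 dot_mx trmx_mul trmxK.
    by rewrite map_trmx mulmxA -(mulmxA v) -map_mxM vG mul0mx mxE.
  by rewrite det_map_mx intr_eq0.
- apply/BU; exists (\adj G *m B^T *m l)%:RM.
  by rewrite /int_vec -!mulmxA map_mxM.
- move=> _ /BU[c ->].
  suff B0 : B^T *m (\det G *: l - B *m \adj G *m B^T *m l) = 0.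
    rewrite dotC dot_mx trmx_mul map_trmx -(mulmxA c^T) -map_mxM B0.
    by rewrite map_mx0 mulmx0 mxE.
  rewrite mulmxBr -scalemxAr !mulmxA -/G mul_mx_adj.
  by rewrite mul_scalar_mx -scalemxAl subrr.
Qed.

(** A subgroup of the integer lattice with torsion-free quotient. These are the annihilators of
    subtori, whereas a subgroup that is not primitive annihilates a disconnected group. *)
Definition primitive_subgroup (M : set 'cV[int]_k) :=
  [/\ M 0, forall l m, M l -> M m -> M (l - m) &
    forall (z : int) (l : 'cV[int]_k), z != 0 -> M (z *: l) -> M l].

(** The alternative [z i = 0] allows expansions in a full basis of which only some vectors belong to
    [M]. *)
Lemma primitive_subgroup_sum (M : set 'cV[int]_k) (I : Type) (r : seq I)
    (z : I -> int) (F : I -> 'cV[int]_k) :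
  primitive_subgroup M -> (forall i, z i = 0 \/ M (F i)) ->
  M (\sum_(i <- r) z i *: F i).
Proof.
move=> [M0 MB _].
have MN l : M l -> M (- l) by move=> Ml; rewrite -sub0r; exact: MB.
have MD l m : M l -> M m -> M (l + m).
  by move=> Ml Mm; rewrite -[m]opprK; exact/MB/MN.
have MZn (n : nat) l : M l -> M (l *+ n).
  by move=> Ml; elim: n => [|n IH]; rewrite ?mulr0n ?mulrS//; exact: MD.
have MZ (y : int) l : M l -> M (y *: l).
  move=> Ml; rewrite -[y]intz scaler_int; case: y => n; first exact: MZn.
  by rewrite NegzE mulrNz; exact/MN/MZn.
move=> MF; elim/big_ind: _ => // i _.
by have [->|/MZ//] := MF i; rewrite scale0r.
Qed.

(** No generating family of [M] is needed: a finite family of maximal real rank has the same real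
    span as [M], and its Smith form together with division inside [M] yields rows of a unimodular
    matrix. *)
Lemma primitive_subgroup_unimodular (M : set 'cV[int]_k) :
  primitive_subgroup M ->
  exists Q (Z : {set 'I_k}), [/\ Q \in unitmx,
    forall i, i \in Z -> M (row i Q)^T &
    forall m v, M m -> (forall i, i \in Z -> (Q%:RM *m v) i 0 = 0) ->
      dot (int_vec R m) v = 0].
Proof.
move=> Mp; have [M0 MB Mprim] := Mp.
pose P (n : nat) := `[< exists s (B : 'M[int]_(s, k)), (forall i, M (row i B)^T) /\
  \rank B%:RM = n >].
have exP : exists n, P n.
  exists 0%N; apply/asboolP; exists 0%N, 0; split=> [[]//|].
  by rewrite map_mx0 mxrank0.
have ubP n : P n -> (n <= k)%N.
  by move=> /asboolP[s [B [_ <-]]]; exact: rank_leq_col.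
case: (ex_maxnP exP ubP) => n /asboolP[s [B [MB_ Bn]]] nmax.
(* Adjoining [m] as a new row cannot raise the maximal rank, so it already lies in the real row
   space. *)
have Bspan m : M m -> ((int_vec R m)^T <= B%:RM)%MS.
  move=> Mm; pose C := col_mx B m^T.
  have BC : (B%:RM <= C%:RM)%MS by rewrite map_col_mx -addsmxE addsmxSl.
  have CB : (\rank C%:RM <= \rank B%:RM)%N.
    rewrite Bn; apply: nmax; apply/asboolP; exists (s + 1)%N, C; split=> // i.
    case: (split_ordP i) => j ->; first by rewrite rowKu.
    by rewrite rowKd row_id trmxK.
  apply: submx_trans (_ : (C%:RM <= B%:RM)%MS).
    by rewrite map_col_mx -addsmxE map_trmx addsmxSr.
  by rewrite -(geq_leqif (mxrank_leqif_sup BC)).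
have [L Lu [Q Qu [d _ BE]]] := int_Smith_normal_form B.
pose D := \matrix_(i < s, j < k) (d`_i *+ (i == j :> nat)).
(* The rows of D Q are integer combinations of rows of B, hence in [M]; dividing by a nonzero
   diagonal entry leaves the row of Q itself in [M]. *)
have DQ : D *m Q = invmx L *m B.
  by rewrite BE -/D !mulmxA mulVmx// mul1mx.
have MDQ i : M (row i (D *m Q))^T.
  rewrite DQ (_ : _^T = \sum_t (invmx L) i t *: (row t B)^T).
    by apply: primitive_subgroup_sum => // t; right.
  apply/matrixP => p l; rewrite ord1 summxE !mxE.
  by apply: eq_bigr => t _; rewrite !mxE.
exists Q, [set j | [exists i, D i j != 0]]%SET; split=> // [j|m v Mm v0].
  rewrite inE => /existsP[i Dij]; apply: (Mprim (D i j)) => //.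
  rewrite (_ : _ *: _ = (row i (D *m Q))^T)//.
  move: Dij; rewrite mxE; have [ij _|_] := eqVneq (val i) (val j); last first.
    by rewrite mulr0n eqxx.
  apply/matrixP => p l; rewrite ord1 !mxE (bigD1 j)//= big1 => [|j' j'j].
    by rewrite !mxE ij eqxx addr0.
  rewrite !mxE ij (_ : _ == _ = false) ?mulr0n ?mul0r//.
  by apply: contraNF j'j => /eqP e; apply/eqP/val_inj.
have Bv : B%:RM *m v = 0.
  rewrite BE -/D !map_mxM -!mulmxA (_ : D%:RM *m _ = 0) ?mulmx0//.
  apply/matrixP => i l; rewrite ord1 mxE [RHS]mxE big1// => j _.
  have [D0|D0] := eqVneq (D i j) 0; first by rewrite [D%:RM i j]mxE D0 mul0r.
  by rewrite v0 ?mulr0// inE; apply/existsP; exists i.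
have /submxP[w mE] := Bspan _ Mm.
by rewrite dot_mx mE -mulmxA Bv mulmx0 mxE.
Qed.

Lemma primitive_subgroup_annihilator (M : set 'cV[int]_k) :
  primitive_subgroup M ->
  exists V, rational_subspace V /\ forall m, M m <-> orth V (int_vec R m).
Proof.
move=> Mp; have [Q [Z [Qu MQ MV]]] := primitive_subgroup_unimodular Mp.
have [V [ratV VE]] := rational_of_unimodular Z Qu.
exists V; split=> // m; split=> [Mm u /VE|mV]; first exact: MV.
(* [w] holds the coordinates of [m] in the rows of Q. The coordinate at [i] is the pairing of [m]
   with column [i] of [invmx Q], which lies in V when [i] is outside [Z]; so only rows belonging to
   [M] remain. *)
pose w := m^T *m invmx Q.
have mE : m = \sum_i w 0 i *: (row i Q)^T.
  rewrite -[LHS]trmxK -[m^T](mulmxKV Qu) -/w.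
  apply/matrixP => i j; rewrite ord1 summxE !mxE.
  by apply: eq_bigr => l _; rewrite !mxE.
rewrite mE; apply: primitive_subgroup_sum => // i.
have [iZ|iZ] := boolP (i \in Z); [by right; exact: MQ | left].
have : dot (int_vec R m) (col i (invmx Q)%:RM) = 0.
  apply: mV; apply/VE => j jZ.
  rewrite colE mulmxA -map_mxM mulmxV// map_mx1 mul1mx mxE.
  by rewrite (_ : j == i = false)//; apply: contraNF iZ => /eqP <-.
rewrite dot_mx map_trmx colE mulmxA -map_mxM -/w mxE (bigD1 i)//= big1.
  by rewrite !mxE !eqxx mulr1 addr0 => /eqP; rewrite intr_eq0 => /eqP.
by move=> j ji; rewrite [delta_mx _ _ _ _]mxE (negbTE ji) mulr0.
Qed.

End rational_subspaces.

(** * Density of trigonometric polynomials in L1 *)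

(** Such functions are integrable against every probability measure, so the side conditions are the
    same for all the measures to be compared. *)
Definition bounded_measurable {d} {T : measurableType d} {R : realType}
    (f : T -> R) :=
  measurable_fun [set: T] f /\ exists M : R, forall x, `|f x| <= M.

Section bounded_measurable.
Context {d} {T : measurableType d} {R : realType}.
Implicit Types (f g : T -> R) (P : probability T R).

Lemma bounded_measurable_integrable P f :
  bounded_measurable f -> P.-integrable [set: T] (EFin \o f).
Proof.
move=> [mf [M fM]]; apply: measurable_bounded_integrable => //.
  exact: le_lt_trans (probability_le1 P measurableT) (ltry 1).
exists M; split; first exact: num_real.
by move=> r Mr x _ /=; rewrite (le_trans (fM x))// ltW.
Qed.

Lemma integral_EFin_bounded P f : bounded_measurable f ->
  (\int[P]_x (f x)%:E = (\int[P]_x f x)%R%:E)%E.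
Proof.
move=> bf; rewrite /Rintegral fineK//.
exact/integrable_fin_num/bounded_measurable_integrable.
Qed.

Lemma bounded_measurableD f g : bounded_measurable f -> bounded_measurable g ->
  bounded_measurable (fun x => f x + g x).
Proof.
move=> [mf [M fM]] [mg [N gN]]; split; first exact: measurable_funD.
by exists (M + N) => x; rewrite (le_trans (ler_normD _ _))// lerD.
Qed.

Lemma bounded_measurableM f g : bounded_measurable f -> bounded_measurable g ->
  bounded_measurable (fun x => f x * g x).
Proof.
move=> [mf [M fM]] [mg [N gN]]; split; first exact: measurable_funM.
by exists (M * N) => x; rewrite normrM ler_pM.
Qed.

Lemma bounded_measurable_cst c : bounded_measurable (fun _ : T => c : R).
Proof. by split; [exact: measurable_cst | exists `|c|]. Qed.

Lemma bounded_measurableZ c f : bounded_measurable f ->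
  bounded_measurable (fun x => c * f x).
Proof. by apply: bounded_measurableM; exact: bounded_measurable_cst. Qed.

Lemma bounded_measurableB f g : bounded_measurable f -> bounded_measurable g ->
  bounded_measurable (fun x => f x - g x).
Proof.
move=> [mf [M fM]] [mg [N gN]]; split; first exact: measurable_funB.
by exists (M + N) => x; rewrite (le_trans (ler_normB _ _))// lerD.
Qed.

Lemma bounded_measurable_norm f : bounded_measurable f ->
  bounded_measurable (fun x => `|f x|).
Proof.
move=> [mf [M fM]]; split; first exact: measurableT_comp.
by exists M => x; rewrite normr_id.
Qed.

Lemma Rintegral_cst1 P c : \int[P]_x c = c.
Proof.
rewrite Rintegral_cst// -[RHS]mulr1; congr (_ * _).
by have := probability_setT P => /= ->.
Qed.

Lemma le_Rintegral_bounded P f g : bounded_measurable f ->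
  bounded_measurable g -> (forall x, f x <= g x) ->
  \int[P]_x f x <= \int[P]_x g x.
Proof.
by move=> bf bg fg; apply: le_Rintegral => //; exact: bounded_measurable_integrable.
Qed.

Lemma Rintegral_dist_triangle P f g h : bounded_measurable f ->
  bounded_measurable g -> bounded_measurable h ->
  \int[P]_x `|f x - h x| <=
    \int[P]_x `|f x - g x| + \int[P]_x `|g x - h x|.
Proof.
move=> bf bg bh; rewrite -RintegralD//; last 2 first.
- exact/bounded_measurable_integrable/bounded_measurable_norm/bounded_measurableB.
- exact/bounded_measurable_integrable/bounded_measurable_norm/bounded_measurableB.
apply: le_Rintegral_bounded => [||x].
- exact/bounded_measurable_norm/bounded_measurableB.
- by apply: bounded_measurableD; exact/bounded_measurable_norm/bounded_measurableB.
- exact: ler_distD.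
Qed.

Lemma Rintegral_dist_uniform P f g (e : R) : bounded_measurable f ->
  bounded_measurable g -> (forall x, `|f x - g x| <= e) ->
  \int[P]_x `|f x - g x| <= e.
Proof.
move=> bf bg fg; rewrite -[leRHS](Rintegral_cst1 P).
apply: le_Rintegral_bounded => //.
  exact/bounded_measurable_norm/bounded_measurableB.
exact: bounded_measurable_cst.
Qed.

Lemma bounded_convergence P (f_ : nat -> T -> R) f M :
  (forall n, measurable_fun [set: T] (f_ n)) ->
  (forall n x, `|f_ n x| <= M) ->
  (forall x, f_ ^~ x @ \oo --> f x) ->
  bounded_measurable f /\
  forall e : R, 0 < e -> \forall n \near \oo, \int[P]_x `|f x - f_ n x| < e.
Proof.
move=> mf fM ff.
have fMx x : `|f x| <= M.
  have cn : `|f_ n x| @[n --> \oo] --> `|f x| by apply: cvg_norm; exact: ff.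
  rewrite -(cvg_lim (@Rhausdorff R) cn); apply: limr_le; first exact: cvgP cn.
  by near=> n; exact: fM.
have bf : bounded_measurable f.
  split; last by exists M.
  by apply: (@measurable_fun_cvg _ _ _ _ f_) => // x _; exact: ff.
split=> // e e0.
have bf_ n : bounded_measurable (f_ n) by split=> //; exists M.
have [] := @dominated_convergence _ T R P setT measurableT
  (fun n => EFin \o f_ n) (EFin \o f) (cst M%:E).
- by move=> n; exact/measurable_EFinP.
- by apply/measurable_EFinP; case: bf.
- by apply: aeW => x _; apply: cvg_EFin; [exact: nearW | exact: ff].
- exact: bounded_measurable_integrable (bounded_measurable_cst M).
- by apply: aeW => x n _ /=; rewrite lee_fin.
move=> _ /fine_cvgP[_ /cvgrPdist_lt/(_ e e0)] + _.
apply: filterS => n; rewrite sub0r normrN; apply: le_lt_trans.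
rewrite (le_trans _ (ler_norm _))// /Rintegral le_eqVlt; apply/orP; left.
apply/eqP; congr fine; apply: eq_integral => x _ /=.
by rewrite distrC.
Unshelve. all: by end_near.
Qed.

End bounded_measurable.

(** * Continuous approximation of indicators of open sets *)

Section open_indicator.
Context {R : realType} {k : nat}.
Implicit Types (x y z : torus R k).

(** Half the squared chordal distance when each coordinate is placed on the unit circle. Being a
    square it comes without a triangle inequality; the Lipschitz estimate [gap_lip] takes its
    place. *)
Definition torus_gap x y : R :=
  \sum_(i < k) (1 - cos (pi *+ 2 * (repr x i 0 - repr y i 0))).

(** [repr] is chosen without regard to continuity, but these functions are waves, the sine having
    phase -pi/2, hence continuous. *)
Let c i x : R := cos (pi *+ 2 * repr x i 0).
Let s i x : R := sin (pi *+ 2 * repr x i 0).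

Let c_continuous i : continuous (c i).
Proof.
rewrite (_ : c i = wave (delta_mx i 0) 0); first exact: wave_continuous.
by apply/funext => x; rewrite /wave dot_delta addr0.
Qed.

Let s_continuous i : continuous (s i).
Proof.
rewrite (_ : s i = wave (delta_mx i 0) (- (pi / 2))).
  exact: wave_continuous.
by apply/funext => x; rewrite /wave dot_delta cosBpihalf.
Qed.

Let gapE x y :
  torus_gap x y = \sum_(i < k) (1 - (c i x * c i y + s i x * s i y)).
Proof. by apply: eq_bigr => i _; rewrite mulrBr cosB. Qed.

Let osc x y : R := \sum_(i < k) (`|c i x - c i y| + `|s i x - s i y|).

Let gap_lip x y z : torus_gap x z <= osc x y + torus_gap y z.
Proof.
rewrite !gapE -big_split/=; apply: ler_sum => i _.
have h1 : (c i y - c i x) * c i z <= `|c i x - c i y|.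
  rewrite distrC (le_trans (ler_norm _))// normrM ler_piMr//; exact: cos_max.
have h2 : (s i y - s i x) * s i z <= `|s i x - s i y|.
  rewrite distrC (le_trans (ler_norm _))// normrM ler_piMr//; exact: sin_max.
lra.
Qed.

Let osc_continuous x : continuous (osc x).
Proof.
move=> y; apply: continuous_big => [|i _ {}y]; first exact: add_continuous.
have normB (h : torus R k -> R) : continuous h ->
    {for y, continuous (fun z => `|h x - h z|)}.
  move=> ch; apply: (@continuous_comp _ R R (fun z => h x - h z) Num.norm).
    apply: (@continuousB R R^o _ (fun=> h x) h); last exact: ch.
    exact: cst_continuous.
  exact: norm_continuous.
apply: (@continuousD R R^o _ (fun z => `|c i x - c i z|)
  (fun z => `|s i x - s i z|)); exact: normB.
Qed.

Let osc0 x : osc x x = 0.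
Proof. by rewrite /osc big1// => i _; rewrite !subrr normr0 addr0. Qed.

Let oscC x y : osc x y = osc y x.
Proof. by apply: eq_bigr => i _; rewrite distrC (distrC (s i x)). Qed.

Let gap_ge0 x y : 0 <= torus_gap x y.
Proof. by apply: sumr_ge0 => i _; rewrite subr_ge0 cos_le1. Qed.

Let gap0 x : torus_gap x x = 0.
Proof. by rewrite /torus_gap big1// => i _; rewrite subrr mulr0 cos0 subrr. Qed.

Definition gap_to (A : set (torus R k)) x : R :=
  inf [set torus_gap x y | y in A].

Let gap_to_lb A x : has_lbound [set torus_gap x y | y in A].
Proof. by exists 0 => _ [y _ <-]. Qed.

Let gap_to_ge0 A x : A !=set0 -> 0 <= gap_to A x.
Proof.
move=> [y Ay]; apply: lb_le_inf => [|_ [z _ <-]//].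
by exists (torus_gap x y), y.
Qed.

Lemma gap_to_continuous A : A !=set0 -> continuous (gap_to A).
Proof.
move=> A0; have lip x y : gap_to A x <= osc x y + gap_to A y.
  rewrite -lerBlDl; apply: lb_le_inf => [|_ [z Az <-]].
    by case: A0 => z Az; exists (torus_gap y z), z.
  rewrite lerBlDl (le_trans _ (gap_lip x y z))//.
  by apply: ge_inf => //; exists z.
move=> x; suff : gap_to A @ nbhs x --> gap_to A x by exact.
apply/cvgrPdist_lt => e e0.
have : osc x y @[y --> x] --> osc x x by exact: osc_continuous.
rewrite osc0 => /cvgrPdist_lt/(_ e e0); apply: filterS => y.
rewrite sub0r normrN; apply: le_lt_trans; apply: le_trans (ler_norm _).
by rewrite ler_norml lerBrDr addrC lerBlDl lerBlDr lip -oscC lip.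
Qed.

Lemma gap_to_gt0 (O : set (torus R k)) x : open O -> ~` O !=set0 -> O x ->
  0 < gap_to (~` O) x.
Proof.
move=> oO O0 Ox.
have : nbhs (repr x) (@to_torus R k @^-1` O).
  apply: open_nbhs_nbhs; split; last by rewrite /= to_torus_repr.
  by have /continuousP := @to_torus_continuous R k; exact.
rewrite -nbhs_ballE => -[r /= r0 rO].
(* At most [r], so that [d]-close points lie in [O], and below the 1/2 required by [torus_cos_gap];
   a point outside [O] must then satisfy the second alternative of that lemma. *)
pose d := Num.min r (1 / 4).
have dr : d <= r by rewrite ge_min lexx.
have d02 : 0 < d < 1 / 2.
  by rewrite lt_min r0 gt_min/=; apply/andP; split; [|apply/orP; right]; lra.
have [g g0 gap] := torus_cos_gap (k := k) d02.
apply: (lt_le_trans g0); apply: lb_le_inf => [|_ [y yO <-]].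
  by case: O0 => z Az; exists (torus_gap x z), z.
have [[z zd]|//] := gap (repr x) (repr y).
exfalso; apply: yO; rewrite -(to_torus_repr y) -(to_torusBint _ (- z)).
apply: rO; split=> // i j; rewrite ord1 /ball/=; apply: lt_le_trans dr.
by rewrite int_vecN opprK; have := zd i; rewrite !mxE opprD addrA addrAC.
Qed.

Lemma open_indic_cvg (O : set (torus R k)) : open O ->
  exists F : nat -> torus R k -> R, [/\ forall n, continuous (F n),
    forall n x, `|F n x| <= 1 & forall x, F ^~ x @ \oo --> (\1_O x : R)].
Proof.
(* When [O] is the whole torus, [gap_to] would be an infimum over the empty set, and the constant 1
   is used instead of truncated multiples of the gap. *)
move=> oO; have [ne|] := pselect (~` O !=set0); last first.
  move=> /set0P/negP/negPn/eqP/(congr1 (@setC _)); rewrite setCK setC0 => ->.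
  exists (fun _ => cst 1); split=> [n|n x|x].
  - exact: cst_continuous.
  - by rewrite /= normr1.
  - by rewrite indicE in_setT; exact: cvg_cst.
exists (fun n => (fun=> 1) \min (fun x => n%:R * gap_to (~` O) x)).
split=> [n x|n x|x].
- apply: continuous_min; first exact: cst_continuous.
  apply: (@continuousM R _ (fun=> n%:R) (gap_to (~` O))).
    exact: cst_continuous.
  exact: gap_to_continuous.
- by rewrite ger0_norm /= ?ge_min ?lexx// le_min ler01 mulr_ge0// gap_to_ge0.
- rewrite indicE; case: (boolP (x \in O)) => /= [/set_mem Ox|/negP xO].
    apply: cvg_near_cst; have g0 := gap_to_gt0 oO ne Ox.
    near=> n; rewrite min_l// -ler_pdivrMr//; near: n.
    exact: nbhs_infty_ger.
  have {}xO : (~` O) x by move=> Ox; apply: xO; exact: mem_set.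
  have -> : gap_to (~` O) x = 0.
    apply/eqP; rewrite eq_le gap_to_ge0// andbT.
    by apply: ge_inf => //; exists x => //; exact: gap0.
  by under eq_fun do rewrite mulr0 min_r//; exact: cvg_cst.
Unshelve. all: by end_near.
Qed.

End open_indicator.

Lemma sum_indic_trivIset {R : realType} {T : Type} (F : nat -> set T) (x : T) :
  trivIset [set: nat] F ->
  (exists i, F i x /\ forall n, \sum_(j < n) \1_(F j) x = (i < n)%:R :> R) \/
  ((forall i, ~ F i x) /\ forall n, \sum_(j < n) \1_(F j) x = 0 :> R).
Proof.
move=> /trivIsetP tF; have [[i Fi]|nF] := pselect (exists i, F i x); last first.
  right; split=> [i Fi|n]; first by apply: nF; exists i.
  by apply: big1 => j _; rewrite indicE memNset// => Fj; apply: nF; exists j.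
left; exists i; split=> // n.
have Fj j : \1_(F j) x = (j == i)%:R :> R.
  rewrite indicE; have [->|ji] := eqVneq j i; first by rewrite mem_set.
  rewrite memNset// => Fj; have := tF j i Logic.I Logic.I ji.
  by move/disjoints_subset => /(_ x Fj).
under eq_bigr do rewrite Fj.
elim: n => [|n IH]; first by rewrite big_ord0.
rewrite big_ord_recr/= IH -natrD ltnS; congr _%:R.
by case: ltngtP.
Qed.

Section L1_density.
Context {R : realType} {k : nat}.
Local Notation T := (borel (torus R k)).

Lemma continuous_bounded_measurable (f : torus R k -> R) : continuous f ->
  bounded_measurable (f : T -> R).
Proof.
move=> cf; split; last exact: torus_bounded.
apply: (measurability _ (RGenOpens.measurableE R)) => _ [_ [a [b ->]] <-].
rewrite setTI; apply: sub_sigma_algebra.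
by move/continuousP: cf; apply; exact: itv_open.
Qed.

Lemma trig_bounded_measurable (f : torus R k -> R) : trig f ->
  bounded_measurable (f : T -> R).
Proof. by move=> /trig_continuous; exact: continuous_bounded_measurable. Qed.

Lemma trig_integrable (P : probability T R) (f : torus R k -> R) : trig f ->
  P.-integrable [set: T] (EFin \o (f : T -> R)).
Proof.
move=> tf; exact: (bounded_measurable_integrable P (trig_bounded_measurable tf)).
Qed.

(* Two measures at a time: the same trigonometric polynomial is then used to
   compare them. *)
Variable mu : bool -> probability T R.

Definition trig_L1 (h : T -> R) := bounded_measurable h /\ forall e : R, 0 < e ->
  exists2 g, trig g & forall b, \int[mu b]_x `|h x - g x| <= e.

Lemma trig_L1_continuous (f : torus R k -> R) : continuous f ->
  trig_L1 f.
Proof.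
move=> cf; have bf := continuous_bounded_measurable cf; split=> // e e0.
have [g tg fg] := trig_dense cf e0; exists g => // b.
by apply: Rintegral_dist_uniform => //; exact: trig_bounded_measurable.
Qed.

Lemma trig_L1_limit (h_ : nat -> T -> R) h M : (forall n, trig_L1 (h_ n)) ->
  (forall n x, `|h_ n x| <= M) -> (forall x, h_ ^~ x @ \oo --> h x) ->
  trig_L1 h.
Proof.
move=> th hM hh.
have bc b : bounded_measurable h /\ forall e : R, 0 < e ->
    \forall n \near \oo, \int[mu b]_x `|h x - h_ n x| < e.
  by apply: bounded_convergence hM hh => n; have [[]] := th n.
have bh := (bc true).1; split=> // e e0.
have e20 : 0 < e / 2 by rewrite divr_gt0.
have [n hn] : exists n, forall b, \int[mu b]_x `|h x - h_ n x| < e / 2.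
  apply: (@filter_ex _ \oo); near=> n => -[]; near: n.
    by have [_] := bc true; exact.
  by have [_] := bc false; exact.
have [bn /(_ _ e20)[g tg gn]] := th n; exists g => // b.
rewrite (splitr e) (le_trans (Rintegral_dist_triangle _ bh bn _))//.
  exact: trig_bounded_measurable.
by rewrite lerD// ltW.
Unshelve. all: by end_near.
Qed.

Lemma trig_L1D h1 h2 :
  trig_L1 h1 -> trig_L1 h2 -> trig_L1 (fun x => h1 x + h2 x).
Proof.
move=> [b1 t1] [b2 t2]; split=> [|e e0]; first exact: bounded_measurableD.
have e20 : 0 < e / 2 by rewrite divr_gt0.
have [g1 tg1 e1] := t1 _ e20; have [g2 tg2 e2] := t2 _ e20.
exists (fun x => g1 x + g2 x); first exact: trigD.
move=> b; have bg1 := trig_bounded_measurable tg1.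
have bg2 := trig_bounded_measurable tg2.
rewrite (splitr e) (le_trans _ (lerD (e1 b) (e2 b)))//.
rewrite -RintegralD//; last 2 first.
- exact/bounded_measurable_integrable/bounded_measurable_norm/bounded_measurableB.
- exact/bounded_measurable_integrable/bounded_measurable_norm/bounded_measurableB.
apply: le_Rintegral_bounded => [||x].
- by apply/bounded_measurable_norm/bounded_measurableB; exact: bounded_measurableD.
- by apply: bounded_measurableD; exact/bounded_measurable_norm/bounded_measurableB.
- by rewrite opprD addrACA ler_normD.
Qed.

Lemma trig_L1Z c h : trig_L1 h -> trig_L1 (fun x => c * h x).
Proof.
move=> [bh th]; split=> [|e e0]; first exact: bounded_measurableZ.
have c0 : 0 < `|c| + 1 by rewrite ltr_wpDl.
have [|g tg hg] := th (e / (`|c| + 1)); first by rewrite divr_gt0.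
exists (fun x => c * g x) => [|b]; first exact: trigZ.
have bg := trig_bounded_measurable tg.
under eq_Rintegral do rewrite -mulrBr normrM.
rewrite RintegralZl//; last first.
  exact/bounded_measurable_integrable/bounded_measurable_norm/bounded_measurableB.
rewrite (le_trans (ler_wpM2l _ (hg b)))// mulrCA ger_pMr//.
by rewrite ler_pdivrMr// mul1r lerDl.
Qed.

Lemma trig_L1_indic (B : set T) : measurable B -> trig_L1 (\1_B).
Proof.
move=> mB; apply: (@dynkin_induction _ T (@open (torus R k))
  (fun B => trig_L1 (\1_B))) => //.
- by move=> A C; exact: openI.
- rewrite indicT; apply: trig_L1_continuous; exact: cst_continuous.
- move=> O oO; have [F [cF F1 FO]] := open_indic_cvg oO.
  by apply: (@trig_L1_limit F \1_O 1) => // n; exact: trig_L1_continuous.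
- move=> S mS tS.
  have -> : \1_(~` S) = (fun x => cst 1 x + -1 * \1_S x) :> (T -> R).
    apply/funext => x; rewrite !indicE in_setC.
    by case: (x \in S); rewrite /= ?mulr1 ?mulr0 ?subrr ?addr0.
  apply: trig_L1D; last exact: trig_L1Z.
  apply: trig_L1_continuous; exact: cst_continuous.
- move=> F mF tF IH.
  (* Disjointness makes the partial sums 0 or 1 at each point, which is the uniform bound required
     to pass to the limit. *)
  apply: (@trig_L1_limit (fun n x => \sum_(i < n) \1_(F i) x) _ 1).
  + elim=> [|n IHn].
      under eq_fun do rewrite big_ord0.
      apply: trig_L1_continuous; exact: cst_continuous.
    under eq_fun do rewrite big_ord_recr/=.
    exact: trig_L1D.
  + move=> n x; have [[i [_ ->]]|[_ ->]] := sum_indic_trivIset (R := R) x tF.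
      by case: (i < n)%N; rewrite ?normr1 ?normr0.
    by rewrite normr0.
  + move=> x; have [[i [Fi sF]]|[nF sF]] := sum_indic_trivIset (R := R) x tF.
      under eq_fun do rewrite sF; rewrite indicE mem_set; last by exists i.
      apply: cvg_near_cst; near=> n; rewrite (_ : (i < n)%N)//.
      by near: n; exact: nbhs_infty_gt.
    under eq_fun do rewrite sF; rewrite indicE memNset; last by case=> i _ /nF.
    exact: cvg_cst.
Unshelve. all: by end_near.
Qed.

Import HBSimple.

Lemma trig_L1_sfun (h : {sfun T >-> R}) : trig_L1 h.
Proof.
have [s hs] : exists s : seq R,
    forall x, h x = \sum_(y <- s) y * \1_(h @^-1` [set y]) x.
  exists (finmap.enum_fset (fset_set (range h))) => x.
  by rewrite fimfunE fsbig_finite.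
rewrite (_ : _ h = fun x => \sum_(y <- s) y * \1_(h @^-1` [set y]) x); last first.
  exact/funext.
elim: s {hs} => [|y s IH].
  under eq_fun do rewrite big_nil.
  apply: trig_L1_continuous; exact: cst_continuous.
under eq_fun do rewrite big_cons.
by apply: trig_L1D => //; apply/trig_L1Z/trig_L1_indic; exact: measurable_sfunP.
Qed.

End L1_density.

Section Rintegral_extra.
Context {d} {T : measurableType d} {R : realType}.
Implicit Types (f g : T -> R) (P : probability T R).

Lemma Rintegral_dist P f g : bounded_measurable f -> bounded_measurable g ->
  `|\int[P]_x f x - \int[P]_x g x| <= \int[P]_x `|f x - g x|.
Proof.
move=> bf bg; rewrite -RintegralB//; last 2 first.
- exact: bounded_measurable_integrable.
- exact: bounded_measurable_integrable.
apply: le_normr_Rintegral => //.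
exact/bounded_measurable_integrable/bounded_measurableB.
Qed.

Lemma Rintegral_bounded_indic P (B : set T) : measurable B ->
  \int[P]_x \1_B x = fine (P B).
Proof. by move=> mB; rewrite /Rintegral integral_indic// setIT. Qed.

Lemma Rintegral_distribution {d'} {T' : measurableType d'}
    (P : probability T R) (X : {mfun T >-> T'}) (f : T' -> R) :
  bounded_measurable f ->
  \int[distribution P X]_y f y = \int[P]_x f (X x).
Proof.
move=> [mf [M fM]]; rewrite /Rintegral integral_distribution//.
  exact/measurable_EFinP.
apply: (@bounded_measurable_integrable _ _ _ P (f \o X)); split.
  exact: measurableT_comp.
by exists M => x; exact: fM.
Qed.

End Rintegral_extra.

Lemma Rintegral_sum_bounded {d} {T : measurableType d} {R : realType}
    (P : probability T R) (I : Type) (r : seq I) (F : I -> T -> R) :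
  (forall i, bounded_measurable (F i)) ->
  bounded_measurable (fun x => \sum_(i <- r) F i x) /\
  \int[P]_x (\sum_(i <- r) F i x) = \sum_(i <- r) \int[P]_x F i x.
Proof.
move=> bF; elim: r => [|i r [br IH]].
  under eq_fun do rewrite big_nil.
  rewrite big_nil Rintegral_cst1; split=> //; exact: bounded_measurable_cst.
have sE : (fun x => \sum_(j <- i :: r) F j x) =
    fun x => F i x + \sum_(j <- r) F j x.
  by apply/funext => x; rewrite big_cons.
rewrite sE big_cons -IH; split; first exact: bounded_measurableD.
by rewrite RintegralD//; exact: bounded_measurable_integrable.
Qed.

(** * Fourier coefficients and Haar measures of subtori *)

Section fourier.
Context {R : realType} {k : nat}.
Local Notation T := (borel (torus R k)).
Implicit Types (mu nu : probability T R).

Lemma eq_Rintegral_trig mu nu :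
  (forall l a, \int[mu]_x wave l a x = \int[nu]_x wave l a x) ->
  forall g, trig g -> \int[mu]_x g x = \int[nu]_x g x.
Proof.
move=> munu g.
elim=> {g} [l a|f g tf IHf tg IHg|c f tf IH]; first exact: munu.
  by rewrite !RintegralD ?IHf ?IHg//; exact: trig_integrable.
by rewrite !RintegralZl ?IH//; exact: trig_integrable.
Qed.

Lemma eq_measure_wave mu nu :
  (forall l a, \int[mu]_x wave l a x = \int[nu]_x wave l a x) ->
  forall B, measurable B -> mu B = nu B.
Proof.
move=> munu B mB.
suff e : fine (mu B) = fine (nu B).
  by rewrite -[LHS]fineK ?fin_num_measure// e fineK// fin_num_measure.
apply/eqP; rewrite -subr_eq0 -normr_le0; apply/ler_addgt0Pr => e e0.
rewrite add0r -!Rintegral_bounded_indic//.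
have [bB /(_ (e / 2))[|g tg hg]] :=
    trig_L1_indic (fun b => if b then mu else nu) mB.
  by rewrite divr_gt0.
have bg := trig_bounded_measurable tg.
rewrite -(subrK (\int[mu]_x g x) (\int[mu]_x \1_B x)) -addrA (splitr e).
rewrite (le_trans (ler_normD _ _))// lerD//.
  exact: le_trans (Rintegral_dist _ bB bg) (hg true).
rewrite (eq_Rintegral_trig munu tg) distrC.
exact: le_trans (Rintegral_dist _ bB bg) (hg false).
Qed.

Lemma torus_translate_continuous (h : torus R k) :
  continuous (fun x : torus R k => x + h).
Proof.
apply/quotient_continuous.
have -> : (fun x : torus R k => x + h) \o \pi_(torus R k)%qT =
    @to_torus R k \o (fun v => v + repr h).
  apply/funext => v /=.
  by rewrite -[LHS]/(to_torus v + h) -[h in LHS]to_torus_repr -to_torusD.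
move=> v; apply: continuous_comp; last exact: pi_continuous.
apply: (@continuousD R 'cV[R]_k _ id (fun=> repr h)); first exact: cvg_id.
exact: cst_continuous.
Qed.

Definition torus_translate (h : torus R k) : {mfun T >-> T} :=
  HB.pack_for {mfun T >-> T} (fun x : torus R k => x + h)
    (isMeasurableFun.Build _ _ T T (fun x : torus R k => x + h)
      (continuous_borel_measurable (@torus_translate_continuous h))).

Lemma wave_bounded_measurable l a : bounded_measurable (wave l a : T -> R).
Proof. exact/trig_bounded_measurable/trig_wave. Qed.

(** The Fourier coefficient at [l] of the Haar measure of the subtorus, see [haar_wave]. *)
Definition char_trivial (U : {vspace 'cV[R]_k}) (l : 'cV[int]_k) : R :=
  `[< orth U (int_vec R l) >]%:R.

(* A shift by [u] in [U] with [<l, u> = 1/2] changes the sign of the wave. *)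
Lemma haar_wave_nontrivial (U : {vspace 'cV[R]_k}) (lam : probability T R) l a :
  is_haar (subtorus U) lam -> ~ orth U (int_vec R l) ->
  \int[lam]_x wave l a x = 0.
Proof.
move=> [_ lam_inv] /existsNP[u /not_implyP[uU /eqP lu]].
pose v := (2 * dot (int_vec R l) u)^-1 *: u.
have lv : dot (int_vec R l) v = 1 / 2.
  by rewrite dotZr invfM -mulrA mulVf// mulr1 mul1r.
have vU : subtorus U (to_torus v) by exists v => //=; exact: memvZ.
have : \int[distribution lam (torus_translate (to_torus v))]_x wave l a x =
    \int[lam]_x wave l a x.
  rewrite /Rintegral; congr fine; apply: eq_measure_integral => B mB _.
  exact: lam_inv.
rewrite Rintegral_distribution; last exact: wave_bounded_measurable.
under eq_Rintegral do rewrite /= wave_shift lv.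
have -> : a + pi *+ 2 * (1 / 2) = a + pi by field.
under eq_Rintegral do rewrite waveDpi -mulN1r.
rewrite RintegralZl//; first lra.
exact/bounded_measurable_integrable/wave_bounded_measurable.
Qed.

End fourier.

Section subtorus.
Context {R : realType} {k : nat}.
Local Notation T := (borel (torus R k)).
Variables (U : {vspace 'cV[R]_k}) (Q : 'M[int]_k) (Z : {set 'I_k}).
Hypotheses (Qu : Q \in unitmx)
  (UE : forall u, u \in U <-> forall i, i \in Z -> (map_mx intr Q *m u) i 0 = 0).

(** Its terms are nonnegative, and each vanishes exactly when a coordinate of Q x in [Z] is an
    integer; the zero set is therefore the subtorus. *)
Definition subtorus_defect (x : torus R k) : R :=
  \sum_(i in Z) (1 - wave (row i Q)^T 0 x).

Lemma trig_subtorus_defect : trig subtorus_defect.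
Proof.
rewrite /subtorus_defect; under eq_fun do rewrite -big_enum/=.
apply: trig_sum => i; apply: trigD; first exact: trig_cst.
under eq_fun do rewrite -mulN1r.
exact/trigZ/trig_wave.
Qed.

Let dot_row i (v : 'cV[R]_k) :
  dot (int_vec R (row i Q)^T) v = (map_mx intr Q *m v) i 0.
Proof. by rewrite mxE; apply: eq_bigr => j _; rewrite !mxE. Qed.

Lemma subtorusP x : subtorus U x <-> subtorus_defect x = 0.
Proof.
split=> [[u uU <-]|].
  rewrite /subtorus_defect big1// => i iZ.
  by rewrite wave_to_torus dot_row (UE u).1// mulr0 addr0 cos0 subrr.
move=> /eqP; rewrite psumr_eq0 => [/allP x0|i _]; last first.
  by rewrite subr_ge0 cos_le1.
rewrite -(to_torus_repr x); apply: (mem_subtorus_unimodular Qu UE) => i iZ.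
rewrite -dot_row; apply: cos_2pi_eq1.
have := x0 i (mem_index_enum i); rewrite iZ subr_eq0 /wave addr0.
by move=> /eqP <-.
Qed.

Lemma measurable_subtorus : measurable (subtorus U : set T).
Proof.
have [md _] := trig_bounded_measurable trig_subtorus_defect.
have -> : subtorus U = subtorus_defect @^-1` [set 0].
  by apply/seteqP; split=> x /subtorusP.
by rewrite -[X in measurable X]setTI; exact: md.
Qed.

End subtorus.

Section haar.
Context {R : realType} {k : nat}.
Local Notation T := (borel (torus R k)).

Lemma haar_wave (U : {vspace 'cV[R]_k}) (lam : probability T R) l a :
  rational_subspace U -> is_haar (subtorus U) lam ->
  \int[lam]_x wave l a x = char_trivial U l * cos a.
Proof.
move=> ratU haarU; rewrite /char_trivial.
have [lU|lU] := asboolP (orth U (int_vec R l)); last first.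
  by rewrite mul0r; exact: haar_wave_nontrivial haarU lU.
have [Q [Z [Qu UE]]] := rational_unimodular ratU.
have mU := measurable_subtorus Qu UE.
rewrite mul1r -[RHS](Rintegral_cst1 lam) /Rintegral; congr fine.
apply: ae_eq_integral => //.
- by apply/measurable_EFinP; case: (wave_bounded_measurable l a).
- exists (~` subtorus U); split=> /=.
  + exact: measurableC.
  + by rewrite probability_setC// haarU.1 subee.
  + move=> x /= + [u uU ux]; apply=> _.
    by rewrite -ux wave_to_torus lU// mulr0 add0r.
Qed.

(** The nonnegative [subtorus_defect] has integral zero because its frequencies are orthogonal to V,
    so [mu] is carried by the subtorus. A translation along V shifts phases only for frequencies
    whose coefficient is zero, so it preserves all wave integrals. *)
Lemma is_haar_of_wave (V : {vspace 'cV[R]_k}) (mu : probability T R) :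
  rational_subspace V ->
  (forall l a, \int[mu]_x wave l a x = char_trivial V l * cos a) ->
  is_haar (subtorus V) mu.
Proof.
move=> ratV muE; split.
  have [Q [Z [Qu VE]]] := rational_unimodular ratV.
  have mV := measurable_subtorus Qu VE.
  pose g : T -> R := subtorus_defect Q Z.
  have g0 x : 0 <= g x by apply: sumr_ge0 => i _; rewrite subr_ge0 cos_le1.
  have bg : bounded_measurable g.
    exact/trig_bounded_measurable/trig_subtorus_defect.
  have ig : \int[mu]_x g x = 0.
    rewrite /g /subtorus_defect; under eq_Rintegral do rewrite -big_enum/=.
    have bw i : bounded_measurable (fun x : T => 1 - wave (row i Q)^T 0 x).
      apply: bounded_measurableB; last exact: wave_bounded_measurable.
      exact: bounded_measurable_cst.
    have [_ ->] := Rintegral_sum_bounded mu (enum Z) bw.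
    rewrite big_seq big1// => i; rewrite mem_enum => iZ.
    rewrite RintegralB//; last 2 first.
    - exact/bounded_measurable_integrable/bounded_measurable_cst.
    - exact/bounded_measurable_integrable/wave_bounded_measurable.
    rewrite Rintegral_cst1 muE cos0 mulr1 /char_trivial asboolT ?subrr// => u uV.
    have := (VE u).1 uV i iZ; rewrite mxE => <-.
    by apply: eq_bigr => j _; rewrite !mxE.
  have : ae_eq mu [set: T] (EFin \o g) (cst 0).
    apply/ae_eq_integral_abs => //; first by apply/measurable_EFinP; case: bg.
    under eq_integral do rewrite /= ger0_norm//.
    by rewrite integral_EFin_bounded// ig.
  move=> gN; have VN : mu.-negligible (~` subtorus V).
    apply: negligibleS gN => x /=; apply: contra_not => /(_ Logic.I) [gx].
    exact/(subtorusP Qu VE).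
  have /= := probability_setC mu (measurableC mV).
  by rewrite setCK => ->; rewrite measure_negligible ?sube0//; exact: measurableC.
move=> _ B [v vV <-] mB.
pose nu := distribution mu (torus_translate (to_torus v)).
apply: (@eq_measure_wave _ _ nu) => // l a.
rewrite Rintegral_distribution; last exact: wave_bounded_measurable.
under eq_Rintegral do rewrite /= wave_shift.
rewrite !muE /char_trivial; case: asboolP => lV; last by rewrite !mul0r.
by rewrite lV// mulr0 addr0.
Qed.

End haar.

Lemma finite_set_nearN (A : set nat) :
  finite_set A <-> \forall n \near \oo, ~ A n.
Proof.
split=> [/finite_seqP[s ->]|[N _ NA]]; last first.
  apply: sub_finite_set (finite_II N) => n An /=.
  by rewrite ltnNge; apply/negP => /NA.
exists (\max_(i <- s) i).+1 => // n /= sn ns.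
by have := @leq_bigmax_seq _ s xpredT id n ns isT; rewrite leqNgt sn.
Qed.

(** * Mixing *)

Section densities.
Context {d} {T : measurableType d} {R : realType}.
Implicit Types (P nu : probability T R) (h g : T -> R).

Lemma integrable_mul_bounded P h g : P.-integrable [set: T] (EFin \o h) ->
  bounded_measurable g -> P.-integrable [set: T] (EFin \o (fun x => g x * h x)).
Proof.
move=> ih [mg [M gM]].
have : P.-integrable [set: T] ((EFin \o g) \* (EFin \o h))%E.
  apply: integrableMr => //; exists M; split; first exact: num_real.
  by move=> r Mr x _ /=; rewrite (le_trans (gM x))// ltW.
by apply: eq_integrable => // x _; rewrite /= EFinM.
Qed.

Lemma density_of_dominated P nu : nu `<< P ->
  exists2 h : T -> R, P.-integrable [set: T] (EFin \o h) &
    forall g, bounded_measurable g -> \int[nu]_x g x = \int[P]_x (g x * h x).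
Proof.
move=> nuP; pose h := Radon_Nikodym (charge_of_finite_measure nu) P.
have hE : EFin \o (fine \o h) = h.
  by apply/funext => x /=; rewrite fineK//; exact: Radon_Nikodym_fin_num.
exists (fine \o h); first by rewrite hE; exact: Radon_Nikodym_integrable.
move=> g bg; rewrite /Rintegral; congr fine.
rewrite -(Radon_Nikodym_change_of_variables nuP)//; last first.
  exact: bounded_measurable_integrable.
by apply: eq_integral => x _; rewrite -/h -{1}hE EFinM.
Qed.

Lemma dominated_of_density P h : bounded_measurable h -> (forall x, 0 <= h x) ->
  \int[P]_x h x = 1 ->
  exists2 nu : probability T R, nu `<< P &
    forall g, bounded_measurable g -> \int[nu]_x g x = \int[P]_x (g x * h x).
Proof.
move=> bh h0 h1; pose m (A : set T) := (\int[P]_(x in A) (h x)%:E)%E.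
have mh : measurable_fun [set: T] (EFin \o h).
  by apply/measurable_EFinP; case: bh.
have m0 : m set0 = 0%E by exact: integral_set0.
have mge0 A : (0 <= m A)%E by apply: integral_ge0 => x _; rewrite lee_fin.
have madd : semi_sigma_additive m.
  by apply: semi_sigma_additive_nng_induced => // x; rewrite lee_fin.
pose m' : {measure set T -> \bar R} :=
  HB.pack_for {measure set T -> \bar R} m (isMeasure.Build _ _ _ m m0 mge0 madd).
have m'1 : m' [set: T] = 1%E by rewrite /= /m integral_EFin_bounded// h1.
pose nu : probability T R := HB.pack_for (probability T R) m
  (isMeasure.Build _ _ _ m m0 mge0 madd)
  (Measure_isProbability.Build _ _ _ m' m'1).
have nuP : nu `<< P.
  apply/null_content_dominatesP => A mA PA.
  by apply: null_set_integral => //; exact: measurable_funTS.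
exists nu => // g bg; rewrite /Rintegral; congr fine.
rewrite -(Radon_Nikodym_change_of_variables nuP)//; last first.
  exact: bounded_measurable_integrable.
have iRN :=
  @Radon_Nikodym_integrable _ _ _ (charge_of_finite_measure nu) P nuP.
have mg : measurable_fun [set: T] (EFin \o g).
  by apply/measurable_EFinP; case: bg.
apply: ae_eq_integral => //.
- by apply: emeasurable_funM => //; exact: measurable_int iRN.
- under eq_fun do rewrite EFinM.
  exact: emeasurable_funM.
- under [X in ae_eq _ _ _ X]eq_fun do rewrite EFinM.
  (* The Radon-Nikodym derivative and [h] have the same integral over every measurable set, hence
     agree almost everywhere. *)
  apply: ae_eqe_mul2l; apply: integral_ae_eq => // E _ mE.
  by rewrite -Radon_Nikodym_integral.
Qed.

End densities.

Section weak_star.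
Context {R : realType} {k : nat}.
Local Notation T := (borel (torus R k)).
Implicit Types (nus : nat -> probability T R) (nu : probability T R).

Lemma weak_star_Rintegral nus nu (f : torus R k -> R) :
  weak_star_cvg nus nu -> continuous f ->
  \int[nus n]_x f x @[n --> \oo] --> \int[nu]_x f x.
Proof.
move=> cv cf; apply: fine_cvg; rewrite fineK; first exact: cv.
have bf := continuous_bounded_measurable cf.
exact/integrable_fin_num/(bounded_measurable_integrable nu bf).
Qed.

Lemma weak_star_of_wave nus nu :
  (forall l a, \int[nus n]_x wave l a x @[n --> \oo] --> \int[nu]_x wave l a x) ->
  weak_star_cvg nus nu.
Proof.
move=> cw f cf; have bf := continuous_bounded_measurable cf.
under eq_fun do rewrite (integral_EFin_bounded _ bf).
rewrite (integral_EFin_bounded _ bf); apply: cvg_EFin; first exact: nearW.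
have ct g : trig g -> \int[nus n]_x g x @[n --> \oo] --> \int[nu]_x g x.
  elim=> {g} [l a|g h tg IHg th IHh|c g tg IH]; first exact: cw.
    rewrite RintegralD//; try exact: trig_integrable.
    rewrite (_ : (fun n => _) = fun n => \int[nus n]_x g x + \int[nus n]_x h x).
      exact: cvgD.
    by apply/funext => n; rewrite RintegralD//; exact: trig_integrable.
  rewrite RintegralZl//; last exact: trig_integrable.
  rewrite (_ : (fun n => _) = fun n => c * \int[nus n]_x g x).
    by apply: cvgM => //; exact: cvg_cst.
  by apply/funext => n; rewrite RintegralZl//; exact: trig_integrable.
apply/cvgrPdist_le => e e0; have e30 : 0 < e / 3 by rewrite divr_gt0.
have [g tg fg] := trig_dense cf e30; have bg := trig_bounded_measurable tg.
have close (P : probability T R) : `|\int[P]_x f x - \int[P]_x g x| <= e / 3.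
  apply: le_trans (Rintegral_dist _ bf bg) _.
  exact: Rintegral_dist_uniform.
have /cvgrPdist_le/(_ _ e30) := ct _ tg; apply: filterS => n gn.
rewrite (le_trans (ler_distD (\int[nu]_x g x) _ _))//.
have -> : e = e / 3 + (e / 3 + e / 3) by field.
apply: lerD; first exact: close.
rewrite (le_trans (ler_distD (\int[nus n]_x g x) _ _))//.
by apply: lerD => //; rewrite distrC; exact: close.
Qed.

End weak_star.

Section characters.
Context {R : realType} {k : nat}.
Implicit Types (U : {vspace 'cV[R]_k}) (l m : 'cV[int]_k).

Lemma orthD U (v w : 'cV[R]_k) : orth U v -> orth U w -> orth U (v + w).
Proof. by move=> Uv Uw u uU; rewrite dotDl Uv// Uw// addr0. Qed.

Lemma orthN U (v : 'cV[R]_k) : orth U v -> orth U (- v).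
Proof. by move=> Uv u uU; rewrite dotNl Uv// oppr0. Qed.

Lemma orthZ U (c : R) (v : 'cV[R]_k) : orth U v -> orth U (c *: v).
Proof. by move=> Uv u uU; rewrite dotZl Uv// mulr0. Qed.

Lemma orth_intZ U (z : int) l : z != 0 -> orth U (int_vec R (z *: l)) ->
  orth U (int_vec R l).
Proof.
move=> z0; rewrite int_vecZ => /(orthZ z%:~R^-1).
by rewrite scalerA mulVf ?intr_eq0// scale1r.
Qed.

Lemma orth_mem_eq0 U (v : 'cV[R]_k) : v \in U -> orth U v -> v = 0.
Proof. by move=> vU Uv; apply/eqP; rewrite -dot_eq0 Uv. Qed.

Lemma char_trivialDl U l m : orth U (int_vec R l) ->
  char_trivial U (l + m) = char_trivial U m.
Proof.
move=> Ul; rewrite /char_trivial; congr (nat_of_bool _)%:R.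
apply: asbool_equiv_eq; rewrite int_vecD; split; last exact: orthD.
by move=> /(orthD (orthN Ul)); rewrite addKr.
Qed.

(** This converts weak* convergence into an arithmetic condition: two terms within 1/2 of the limit
    differ by less than 1, hence coincide. *)
Lemma cvg_bool (b : nat -> bool) (c : R) : (b n)%:R @[n --> \oo] --> c ->
  exists b0 : bool, c = b0%:R /\ \forall n \near \oo, b n = b0.
Proof.
move=> bc; have half0 : 0 < 1 / 2 :> R by rewrite divr_gt0.
have /cvgrPdist_lt/(_ _ half0) [N _ NP] := bc.
have bN n : (N <= n)%N -> b n = b N.
  move=> Nn; have := NP _ Nn; have := NP _ (leqnn N).
  by case: (b n); case: (b N) => //=; rewrite !ltr_norml; lra.
exists (b N); split; last by exists N.
apply: (cvg_unique _ bc); first exact: Rhausdorff.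
by apply: cvg_near_cst; exists N => // n /= /bN ->.
Qed.

End characters.

Lemma integrable_EFinD {d} {T : measurableType d} {R : realType}
    (P : probability T R) (f g : T -> R) :
  P.-integrable [set: T] (EFin \o f) -> P.-integrable [set: T] (EFin \o g) ->
  P.-integrable [set: T] (EFin \o (fun x => f x + g x)).
Proof. by move=> fi gi; exact: (integrableD measurableT fi gi). Qed.

Lemma integrable_EFinB {d} {T : measurableType d} {R : realType}
    (P : probability T R) (f g : T -> R) :
  P.-integrable [set: T] (EFin \o f) -> P.-integrable [set: T] (EFin \o g) ->
  P.-integrable [set: T] (EFin \o (fun x => f x - g x)).
Proof. by move=> fi gi; exact: (integrableB measurableT fi gi). Qed.

Section asymptotic_independence.
Context {R : realType} {k : nat}.
Local Notation T := (borel (torus R k)).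
Variable P : probability T R.

Import HBSimple.

Lemma trig_dense_L1 (h : T -> R) (e : R) :
  P.-integrable [set: T] (EFin \o h) -> 0 < e ->
  exists2 g, trig g & \int[P]_x `|h x - g x| <= e.
Proof.
move=> ih e0; have e20 : 0 < e / 2 by rewrite divr_gt0.
have [s [si _ hs]] := approximation_sfun_integrable measurableT ih.
have [n hn] : exists n, \int[P]_x `|h x - s n x| <= e / 2.
  move/fine_cvgP : hs => [_ /cvgrPdist_le/(_ _ e20)] /(@filter_ex _ _ _)[n].
  rewrite sub0r normrN => hn; exists n; apply: le_trans hn.
  by rewrite (le_trans _ (ler_norm _)).
(* A single measure is enough here, so both members of the pair are [P]. *)
have [bs /(_ _ e20)[g tg sg]] := trig_L1_sfun (fun=> P) (s n).
have bg := trig_bounded_measurable tg; exists g => //.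
have isg : P.-integrable [set: T] (EFin \o (fun x => `|s n x - g x|)).
  exact/bounded_measurable_integrable/bounded_measurable_norm/bounded_measurableB.
have ihf (f : T -> R) : bounded_measurable f ->
    P.-integrable [set: T] (EFin \o (fun x => `|h x - f x|)).
  move=> bf; apply: (@integrable_norm _ _ _ P _ (fun x => h x - f x)).
  by apply: integrable_EFinB => //; exact: bounded_measurable_integrable.
rewrite (splitr e) (le_trans _ (lerD hn (sg true)))//.
rewrite -RintegralD//; last exact: ihf.
apply: le_Rintegral => // [||x _]; [exact: ihf | | exact: ler_distD].
by apply: integrable_EFinD => //; exact: ihf.
Qed.

(* Since the [psi n] are uniformly bounded, correlations with the waves determine
   correlations with every integrable function. *)
Lemma correlation_cvg (psi : nat -> T -> R) (c : R) :
  (forall n, measurable_fun [set: T] (psi n)) ->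
  (forall n x, `|psi n x| <= 1) -> `|c| <= 1 ->
  (forall l b, \int[P]_x (psi n x * wave l b x) @[n --> \oo] -->
    c * \int[P]_x wave l b x) ->
  forall h : T -> R, P.-integrable [set: T] (EFin \o h) ->
  \int[P]_x (psi n x * h x) @[n --> \oo] --> c * \int[P]_x h x.
Proof.
move=> mpsi psi1 c1 cw h ih.
have bpsi n : bounded_measurable (psi n) by split=> //; exists 1.
have ct g : trig g ->
    \int[P]_x (psi n x * g x) @[n --> \oo] --> c * \int[P]_x g x.
  elim=> {g} [l b|f g tf IHf tg IHg|a g tg IH]; first exact: cw.
    rewrite RintegralD//; try exact: trig_integrable.
    rewrite (_ : (fun n => _) = fun n =>
      \int[P]_x (psi n x * f x) + \int[P]_x (psi n x * g x)).
      by rewrite mulrDr; exact: cvgD.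
    apply/funext => n; under eq_Rintegral do rewrite mulrDr.
    rewrite RintegralD//; apply: integrable_mul_bounded => //;
      exact: trig_integrable.
  rewrite RintegralZl//; last exact: trig_integrable.
  rewrite (_ : (fun n => _) = fun n => a * \int[P]_x (psi n x * g x)).
    by rewrite mulrCA; apply: cvgM => //; exact: cvg_cst.
  apply/funext => n; under eq_Rintegral do rewrite mulrCA.
  rewrite RintegralZl//; apply: integrable_mul_bounded => //.
  exact: trig_integrable.
apply/cvgrPdist_le => e e0; have e30 : 0 < e / 3 by rewrite divr_gt0.
have [g tg hg] := trig_dense_L1 ih e30; have ig := trig_integrable P tg.
have ihg := integrable_EFinB ih ig.
(* Used for each [psi n] and also for the constant [c], which is why [c] is bounded by 1 as well. *)
have close (f : T -> R) : bounded_measurable f -> (forall x, `|f x| <= 1) ->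
    `|\int[P]_x (f x * h x) - \int[P]_x (f x * g x)| <= e / 3.
  move=> bf f1; apply: le_trans hg.
  rewrite -RintegralB//; try exact: integrable_mul_bounded.
  have ifhg := integrable_EFinB (integrable_mul_bounded ih bf)
    (integrable_mul_bounded ig bf).
  apply: le_trans (le_normr_Rintegral _ ifhg) _ => //.
  apply: le_Rintegral => // [||x _]; try exact: integrable_norm.
  by rewrite -mulrBr normrM ler_piMl.
have cE (f : T -> R) : P.-integrable [set: T] (EFin \o f) ->
    c * \int[P]_x f x = \int[P]_x (c * f x).
  by move=> fi; rewrite RintegralZl.
have /cvgrPdist_le/(_ _ e30) := ct _ tg; apply: filterS => n gn.
rewrite (le_trans (ler_distD (c * \int[P]_x g x) _ _))//.
have -> : e = e / 3 + (e / 3 + e / 3) by field.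
apply: lerD.
  by rewrite !cE//; apply: close => //; exact: bounded_measurable_cst.
rewrite (le_trans (ler_distD (\int[P]_x (psi n x * g x)) _ _))//.
by apply: lerD => //; rewrite distrC; exact: close.
Qed.

End asymptotic_independence.

(** * The limit measure and the resonance criterion *)

Section limit_measure.
Context {R : realType} {d1 d2 : nat}.
Variables (U : {vspace 'cV[R]_d1}) (U_rat : rational_subspace U).
Variables (lamU : probability (borel (torus R d1)) R).
Hypothesis lamU_haar : is_haar (subtorus U) lamU.
Variables (gamma : nat -> 'M[int]_(d2, d1)).
Variables (mu : probability (borel (torus R d2)) R).
Hypothesis gamma_lamU_cvg :
  weak_star_cvg (fun n => distribution lamU (torus_hom R (gamma n))) mu.

Let J (n : nat) (m : 'cV[int]_d2) : R := char_trivial U ((gamma n)^T *m m).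

Lemma Rintegral_wave_push (P : probability (borel (torus R d1)) R)
    (A : 'M[int]_(d2, d1)) (m : 'cV[int]_d2) (a : R) :
  \int[distribution P (torus_hom R A)]_x wave m a x =
  \int[P]_x wave (A^T *m m) a x.
Proof.
rewrite Rintegral_distribution; last exact: wave_bounded_measurable.
by apply: eq_Rintegral => x _; exact: wave_torus_map.
Qed.

Lemma wave_push_cvg m a : J n m * cos a @[n --> \oo] --> \int[mu]_x wave m a x.
Proof.
have := weak_star_Rintegral gamma_lamU_cvg (@wave_continuous R d2 m a).
by under eq_fun do rewrite Rintegral_wave_push (haar_wave _ _ U_rat lamU_haar).
Qed.

Definition eventually_trivial (m : 'cV[int]_d2) :=
  \forall n \near \oo, orth U (int_vec R ((gamma n)^T *m m)).

Lemma eventually_trivial_subgroup : primitive_subgroup eventually_trivial.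
Proof.
split=> [|l m|z l z0].
- apply: nearW => n; rewrite mulmx0 int_vec0 => u _.
  by rewrite dot_mx trmx0 mul0mx mxE.
- apply: filterS2 => n hl hm; rewrite mulmxBr int_vecB.
  by apply: orthD => //; exact: orthN.
- by apply: filterS => n; rewrite -scalemxAr; exact: orth_intZ.
Qed.

Lemma limit_subspace : exists V : {vspace 'cV[R]_d2}, rational_subspace V /\
  (forall m, \forall n \near \oo, J n m = char_trivial V m) /\
  (forall m a, \int[mu]_x wave m a x = char_trivial V m * cos a).
Proof.
have [V [ratV VE]] :=
  primitive_subgroup_annihilator (R := R) eventually_trivial_subgroup.
have JV m : \forall n \near \oo, J n m = char_trivial V m.
  (* Phase 0 isolates the coefficient [J n m] itself, a convergent sequence of zeros and ones. It
     stabilises for each [m] separately, with no uniformity in [m]. *)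
  have := @wave_push_cvg m 0; under eq_fun do rewrite cos0 mulr1.
  move=> /cvg_bool[b0 [_ Jb]]; case: b0 Jb => Jb.
    have /VE Vm : eventually_trivial m.
      by apply: filterS Jb => n /asboolP.
    by apply: filterS Jb => n; rewrite /J /char_trivial (asboolT Vm) => ->.
  have nVm : ~ orth V (int_vec R m).
    move=> /VE Vm; have : \forall n \near \oo, False.
      by apply: filterS2 Vm Jb => n hn /asboolP.
    by move=> /(@filter_ex _ _ _)[].
  by apply: filterS Jb => n; rewrite /J /char_trivial (asboolF nVm) => ->.
exists V; split=> //; split=> // m a.
apply: (cvg_unique _ (@wave_push_cvg m a)); first exact: Rhausdorff.
by apply: cvg_near_cst; apply: filterS (JV m) => n ->.
Qed.

Definition resonance := exists (m : 'cV[int]_d2) (l : 'cV[int]_d1),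
  [/\ l != 0, int_vec R l \in U &
    infinite_set [set n : nat | orth U (int_vec R ((gamma n)^T *m m + l))]].

(* An integer vector outside [U^perp] need not lie in [U], but an integer multiple
   of it differs from an integer vector of [U] by an element of [U^perp]. *)
Lemma eventually_not_resonant m l : ~ resonance -> ~ orth U (int_vec R l) ->
  \forall n \near \oo, char_trivial U ((gamma n)^T *m m + l) = 0 :> R.
Proof.
move=> noR Ul; have [N [p [N0 pU Np]]] := rational_projection l U_rat.
have p0 : p != 0.
  apply/eqP => p0; apply: Ul; apply: (orth_intZ N0).
  by move: Np; rewrite p0 subr0.
have /finite_set_nearN : finite_set
    [set n : nat | orth U (int_vec R ((gamma n)^T *m (N *: m) + p))].
  by apply: contrapT => inf; apply: noR; exists (N *: m), p.
apply: filterS => n nr; rewrite /char_trivial asboolF// => ml; apply: nr => /=.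
have -> : (gamma n)^T *m (N *: m) + p =
    N *: ((gamma n)^T *m m + l) - (N *: l - p).
  by rewrite scalerDr -scalemxAr opprB addrACA subrr addr0.
rewrite int_vecB; apply: orthD; last exact: orthN.
by rewrite int_vecZ; exact: orthZ.
Qed.

(** With h the density of an absolutely continuous measure, integrating a wave against its
    push-forward is a correlation of h with the wave of frequency gamma_n^t m; [correlation_cvg]
    reduces h to a single wave [l]. *)
Lemma mixes_of_not_resonant : ~ resonance ->
  mixes (fun n => torus_hom R (gamma n)) lamU mu.
Proof.
move=> noR; have [V [_ [JV muE]]] := limit_subspace.
move=> eta etaU; apply: weak_star_of_wave => m a.
have [h ih etaE] := density_of_dominated etaU.
have h1 : \int[lamU]_x h x = 1.
  have := etaE _ (@bounded_measurable_cst _ _ R 1); rewrite Rintegral_cst1 => ->.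
  by apply: eq_Rintegral => x _; rewrite mul1r.
have pushE n : \int[distribution eta (torus_hom R (gamma n))]_x wave m a x =
    \int[lamU]_x (wave ((gamma n)^T *m m) a x * h x).
  by rewrite Rintegral_wave_push etaE//; exact: wave_bounded_measurable.
under eq_fun do rewrite pushE.
rewrite muE -(mulr1 (char_trivial V m * cos a)) -h1.
apply: correlation_cvg ih => //.
- by move=> n; case: (wave_bounded_measurable ((gamma n)^T *m m) a).
- by move=> n x; exact: wave_le1.
- rewrite normrM (le_trans _ (cos_max a))// ler_piMl//.
  by rewrite /char_trivial; case: `[< _ >]; rewrite ?normr1 ?normr0.
move=> l b; rewrite (haar_wave _ _ U_rat lamU_haar).
have prodE n : \int[lamU]_x (wave ((gamma n)^T *m m) a x * wave l b x) =
    (char_trivial U ((gamma n)^T *m m + l) * cos (a + b) +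
     char_trivial U ((gamma n)^T *m m - l) * cos (a - b)) / 2.
  under eq_Rintegral do rewrite waveM.
  rewrite RintegralZr//; last first.
    by apply: integrable_EFinD; exact/trig_integrable/trig_wave.
  rewrite RintegralD//; try exact/trig_integrable/trig_wave.
  by rewrite !(haar_wave _ _ U_rat lamU_haar).
under eq_fun do rewrite prodE.
apply: cvg_near_cst.
(* If [l] is orthogonal to U, adding or subtracting it changes no coefficient, and the two cosines
   average to cos a cos b. Otherwise both coefficients vanish eventually, neither [l] nor [- l]
   being orthogonal to U. *)
have [Ul|Ul] := pselect (orth U (int_vec R l)).
  apply: filterS (JV m) => n Jn.
  rewrite ![_ *m m + _]addrC !char_trivialDl//; last first.
    by rewrite int_vecN; exact: orthN.
  rewrite -/(J n m) Jn [X in _ = _ * (X * _)]/char_trivial (asboolT Ul) mul1r.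
  by rewrite -mulrDr -mulrA -cosM mulrA.
have Ul' : ~ orth U (int_vec R (- l)).
  by rewrite int_vecN => /orthN; rewrite opprK.
have := eventually_not_resonant m noR Ul'.
have := eventually_not_resonant m noR Ul.
apply: filterS2 => n -> ->.
by rewrite [in RHS]/char_trivial (asboolF Ul) !mul0r !mulr0 addr0 mul0r.
Qed.

Lemma not_resonant_of_mixes :
  mixes (fun n => torus_hom R (gamma n)) lamU mu -> ~ resonance.
Proof.
move=> mix [m [l [l0 lU]]]; apply; apply/finite_set_nearN.
have Ul : ~ orth U (int_vec R l).
  by move=> /(orth_mem_eq0 lU)/eqP; rewrite int_vec_eq0 (negbTE l0).
have bw a (p : 'cV_d1) := @wave_bounded_measurable R d1 p a.
pose h (x : borel (torus R d1)) := 1 + wave l 0 x.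
have bh : bounded_measurable h.
  by apply: bounded_measurableD => //; exact: bounded_measurable_cst.
have h0 x : 0 <= h x by rewrite /h addrC -lerBlDr sub0r cos_geN1.
have h1 : \int[lamU]_x h x = 1.
  rewrite RintegralD//; try exact: bounded_measurable_integrable.
    rewrite Rintegral_cst1 (haar_wave _ _ U_rat lamU_haar) /char_trivial.
    by rewrite (asboolF Ul) mul0r addr0.
  exact/bounded_measurable_integrable/bounded_measurable_cst.
have [eta etaU etaE] := dominated_of_density bh h0 h1.
have := weak_star_Rintegral (mix eta etaU) (@wave_continuous R d2 m 0).
have intE n : \int[distribution eta (torus_hom R (gamma n))]_x wave m 0 x =
    J n m + (char_trivial U ((gamma n)^T *m m + l) +
             char_trivial U ((gamma n)^T *m m - l)) / 2.
  rewrite Rintegral_wave_push etaE//.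
  under eq_Rintegral do rewrite mulrDr mulr1 waveM.
  rewrite RintegralD//; try exact: bounded_measurable_integrable; last first.
    apply: bounded_measurable_integrable; apply: bounded_measurableM.
      exact: bounded_measurableD.
    exact: bounded_measurable_cst.
  rewrite RintegralZr//; last first.
    exact/bounded_measurable_integrable/bounded_measurableD.
  rewrite RintegralD//; try exact: bounded_measurable_integrable.
  by rewrite !(haar_wave _ _ U_rat lamU_haar) addr0 subr0 cos0 !mulr1.
under eq_fun do rewrite intE.
move=> cv1; have := @wave_push_cvg m 0; under eq_fun do rewrite cos0 mulr1.
move=> cv2; have half0 : 0 < 1 / 2 :> R by rewrite divr_gt0.
(* The push-forwards of [lamU] and of [eta] both converge to [mu], so the excess due to the density
   tends to zero. *)
have cv0 : (char_trivial U ((gamma n)^T *m m + l) +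
    char_trivial U ((gamma n)^T *m m - l)) / 2 @[n --> \oo] --> (0 : R).
  rewrite -(subrr (\int[mu]_x wave m 0 x)); apply: cvg_trans (cvgB cv1 cv2).
  by apply: near_eq_cvg; apply: nearW => n /=; rewrite [LHS]addrAC subrr add0r.
move/cvgrPdist_lt : cv0 => /(_ _ half0); apply: filterS => n.
rewrite sub0r normrN /= => + ml.
(* At a resonant index the first coefficient is 1 and the second is nonnegative, so the excess is at
   least 1/2. *)
rewrite {1}/char_trivial (asboolT ml) ger0_norm ?divr_ge0 ?addr_ge0//.
by rewrite ltr_pM2r ?invr_gt0// gtrDl /char_trivial ltrn0.
Qed.

End limit_measure.

Theorem lemma4p3 (R : realType) (d1 d2 : nat) (d1_gt0 : (0 < d1)%N)
    (d2_gt0 : (0 < d2)%N) (U : {vspace 'cV[R]_d1})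
    (U_rat : rational_subspace U)
    (lamU : probability (borel (torus R d1)) R)
    (lamU_haar : is_haar (subtorus U) lamU)
    (gamma : nat -> 'M[int]_(d2, d1))
    (mu : probability (borel (torus R d2)) R)
    (gamma_lamU_cvg :
      weak_star_cvg (fun n => distribution lamU (torus_hom R (gamma n))) mu) :
  exists V : {vspace 'cV[R]_d2},
    [/\ rational_subspace V, is_haar (subtorus V) mu &
      mixes (fun n => torus_hom R (gamma n)) lamU mu <->
      ~ exists (m : 'cV[int]_d2) (k : 'cV[int]_d1),
          [/\ k != 0, int_vec R k \in U &
            infinite_set [set n : nat |
              orth U (int_vec R ((gamma n)^T *m m + k))]]].
Proof.
have [V [ratV [_ muE]]] := limit_subspace U_rat lamU_haar gamma_lamU_cvg.
exists V; split=> //; first exact: is_haar_of_wave.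
split.
  exact: (not_resonant_of_mixes U_rat lamU_haar gamma_lamU_cvg).
exact: (mixes_of_not_resonant U_rat lamU_haar gamma_lamU_cvg).
Qed.
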